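(* Let $n\ge 1$ and let $u\in\mathbb S^{n-1}$ be fixed. For $\Phi\in\mathcal K_1(\mathbb R)\widehat\otimes\,\mathcal U(\mathbb C^n)$ and $g\in\mathcal K_1(\mathbb R)$ put $$DS^*_{g,u}\Phi(t)=\int_{\mathbb R^n}\int_{\mathbb R}\Phi(x,\xi)\,g(u\cdot t-x)\,e^{2\pi i\xi\cdot t}\,dx\,d\xi,\qquad t\in\mathbb R^n.$$ Then the bilinear mapping $$DS^*:\ \bigl(\mathcal K_1(\mathbb R)\widehat\otimes\,\mathcal U(\mathbb C^n)\bigr)\times\mathcal K_1(\mathbb R)\to\mathcal K_1(\mathbb R^n),\qquad (\Phi,g)\mapsto DS^*_{g,u}\Phi,$$ is continuous.
   Context: $\mathbb S^{n-1}$ is the unit sphere of $\mathbb R^n$. $\mathcal K_1(\mathbb R^n)$ is the space of $\varphi\in C^\infty(\mathbb R^n)$ for which all norms $\rho_k(\varphi)=\sup_{t\in\mathbb R^n,\,|\alpha|\le k}e^{k|t|}|\varphi^{(\alpha)}(t)|$, $k\in\mathbb N_0$, are finite, topologized by these norms. $\mathcal U(\mathbb C^n)$ is the space of entire functions $\varphi$ on $\mathbb C^n$ such that $\theta_k(\varphi)=\sup_{z\in\Pi_k}(1+|z|^2)^{k/2}|\varphi(z)|<\infty$ for all $k\in\mathbb N_0$, where $\Pi_k=\mathbb R^n+i[-k,k]^n$, topologized by these norms. $\mathcal K_1(\mathbb R)\widehat\otimes\,\mathcal U(\mathbb C^n)$ is the completion of the tensor product in the $\pi$-topology (equivalently the $\varepsilon$-topology);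 it consists of functions $\Phi(x,z)$, smooth in $x\in\mathbb R$ and entire in $z\in\mathbb C^n$, and its topology is given by the norms $$\rho^l_k(\Phi)=\sup_{(x,z)\in\mathbb R\times\Pi_k}e^{k|x|}(1+|z|^2)^{k/2}\left|\frac{\partial^l}{\partial x^l}\Phi(x,z)\right|,\qquad k,l\in\mathbb N_0.$$ *)

(* Defs.v *)
From HB Require Import structures.
From mathcomp Require Import all_boot all_order all_algebra.
From mathcomp Require Import all_classical all_reals all_analysis.
From mathcomp.real_closed Require Import complex.

Set Implicit Arguments.
Unset Strict Implicit.
Unset Printing Implicit Defensive.

Import Order.TTheory GRing.Theory Num.Theory.
Import numFieldNormedType.Exports.
Import ComplexField.Normc.

Local Open Scope classical_set_scope.
Local Open Scope ring_scope.
Local Open Scope complex_scope.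

(* real_closed makes [Rcomplex R], a copy of [R[i]], a module over [R] with an
   [R]-valued modulus [normc].  With the topology of that norm, functions of
   real variables with complex values are covered by [derivable] and ['D_v],
   while [R[i]^o] is the module over [R[i]] used for complex derivatives. *)
Section Rcomplex_normed.
Variable R : realType.

HB.instance Definition _ :=
  PseudoMetric.copy (Rcomplex R) (pseudoMetric_normed (Rcomplex R)).
HB.instance Definition _ := isPointed.Build (Rcomplex R) (0 : Rcomplex R).
HB.instance Definition _ :=
  NormedZmod_PseudoMetric_eq.Build R (Rcomplex R) erefl.

Lemma Rcomplex_normrZ (l : R) (x : Rcomplex R) : `|l *: x| = `|l| * `|x|.
Proof.
case: x => a b; rewrite /Num.norm /= /GRing.scale /=.
by rewrite !exprMn -mulrDr sqrtrM ?sqr_ge0// sqrtr_sqr.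
Qed.

HB.instance Definition _ :=
  PseudoMetricNormedZmod_Lmodule_isNormedModule.Build R (Rcomplex R)
    Rcomplex_normrZ.
End Rcomplex_normed.


Section seminorm_topology.
Context {R : realType} {I : eqType} {V : zmodType} (p : I -> V -> \bar R).

(* Neighborhoods of [x] for the topology given by the family [p]: they contain
   a ball for finitely many of the [p i]. *)
Definition seminorm_nbhs (x : V) : set_system V :=
  filter_from [set se : seq I * R | 0 < se.2]
    (fun se => [set y | forall i, i \in se.1 -> (p i (y - x) < se.2%:E)%E]).

Hypothesis p0 : forall i, (p i 0 <= 0)%E.
Hypothesis pD : forall i x y, (p i (x + y) <= p i x + p i y)%E.

Lemma seminorm_nbhs_filter (x : V) : ProperFilter (seminorm_nbhs x).
Proof.
apply: filter_from_proper; first apply: filter_from_filter.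
- by exists ([::], 1) => /=.
- move=> [s e] [s' e'] /= e0 e'0.
  exists (s ++ s', Num.min e e') => /=; first by rewrite lt_min e0.
  move=> y /= ys; split=> i iS.
  + apply: lt_le_trans (ys i _) _; first by rewrite mem_cat iS.
    by rewrite lee_fin ge_min lexx.
  + apply: lt_le_trans (ys i _) _; first by rewrite mem_cat iS orbT.
    by rewrite lee_fin ge_min lexx orbT.
- move=> [s e] /= e0; exists x => i _ /=.
  by rewrite subrr (le_lt_trans (p0 i))// lte_fin.
Qed.

Lemma seminorm_nbhs_singleton (x : V) (A : set V) : seminorm_nbhs x A -> A x.
Proof.
move=> [[s e] /= e0]; apply => i _ /=.
by rewrite subrr (le_lt_trans (p0 i))// lte_fin.
Qed.

Lemma seminorm_nbhs_nbhs (x : V) (A : set V) :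
  seminorm_nbhs x A -> seminorm_nbhs x (seminorm_nbhs^~ A).
Proof.
move=> [[s e] /= e0 sA]; exists (s, e / 2) => /=; first by rewrite divr_gt0.
move=> y /= yx; exists (s, e / 2) => /=; first by rewrite divr_gt0.
move=> z /= zy; apply: sA => i iS /=.
have -> : z - x = (z - y) + (y - x) by rewrite addrA subrK.
apply: le_lt_trans (pD i _ _) _.
by rewrite [e]splitr EFinD lteD// ?zy ?yx.
Qed.

End seminorm_topology.

Section complex_valued.
Variable R : realType.
Local Notation C := R[i].
Local Notation RC := (Rcomplex R).

Lemma cvg_mulC (T : Type) (F : set_system T) {FF : Filter F} (a : C)
    (q : T -> RC) (l : RC) :
  q x @[x --> F] --> l -> ((a * q x : C) : RC) @[x --> F] --> ((a * l : C) : RC).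
Proof.
move=> /cvgrPdist_lt ql; apply/cvgrPdist_lt => e e0.
have a1 : 0 < normc a + 1 by rewrite ltr_wpDl// (normr_ge0 (a : RC)).
have := ql (e / (normc a + 1)) (divr_gt0 e0 a1).
apply: filterS => x; rewrite ltr_pdivlMr// => xe.
have -> : ((a * l : C) : RC) - (a * q x : C) = (a * (l - q x : RC) : C).
  by rewrite mulrBr.
rewrite [ltLHS]normcM; apply: le_lt_trans xe.
by rewrite mulrC ler_wpM2l// ?(normr_ge0 (_ : RC))// lerDl.
Qed.

Section lincomb.
Variables (V : normedModType R) (a : C) (f g : V -> C) (t v : V).
Hypothesis df : derivable (f : V -> RC) t v.
Hypothesis dg : derivable (g : V -> RC) t v.

Let D_lincomb : (h^-1 *: (((a *: f + g) (h *: v + t) : RC)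
   - (a *: f + g) t)) @[h --> 0^'] -->
  ((a * 'D_v (f : V -> RC) t : C) : RC) + 'D_v (g : V -> RC) t.
Proof.
have cf := cvg_mulC (a := a) (FF := dnbhs_filter (0 : R)) df.
apply: cvg_trans (cvgD cf dg); apply: near_eq_cvg.
near=> h; rewrite /= !fctE.
have scaleE (r : R) (x : RC) : r *: x = (r%:C * x : C).
  by case: x => x1 x2; rewrite /GRing.mul/= !mul0r subr0 addr0.
have mulZ (r : R) (x : RC) :
    ((a * (r *: x : RC) : C) : RC) = r *: ((a * x : C) : RC).
  by rewrite !scaleE mulrCA.
rewrite mulZ -scalerDr; congr (_ *: _).
rewrite [in RHS]opprD [RHS]addrACA; congr (_ + _).
exact: mulrBr.
Unshelve. all: by end_near. Qed.

Lemma derivable_lincomb : derivable (a *: f + g : V -> RC) t v.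
Proof. exact: cvgP D_lincomb. Qed.

Lemma derive_lincomb :
  'D_v (a *: f + g : V -> RC) t =
  (a * 'D_v (f : V -> RC) t : C) + 'D_v (g : V -> RC) t.
Proof. exact: cvg_lim D_lincomb. Qed.

End lincomb.

Section wsup.
Variables (J K : Type) (A : set J) (B : set K) (w : J -> K -> R).
Hypothesis w0 : forall j k, 0 <= w j k.
Implicit Types h : J -> K -> C.

Let wsup h := ereal_sup [set (w j k * normc (h j k))%:E | j in A & k in B].

Lemma wsup0 h : (forall j k, h j k = 0) -> (wsup h <= 0)%E.
Proof.
move=> h0; apply: ge_ereal_sup => _ [j _ [k _ <-]].
by rewrite h0 normc0 mulr0.
Qed.

Lemma wsupD h h1 h2 : (forall j k, h j k = h1 j k + h2 j k) ->
  (wsup h <= wsup h1 + wsup h2)%E.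
Proof.
move=> hD; apply: ge_ereal_sup => _ [j Aj [k Bk <-]]; rewrite hD.
apply: (@le_trans _ _ ((w j k * normc (h1 j k))%:E + (w j k * normc (h2 j k))%:E)%E).
  rewrite -EFinD lee_fin -mulrDr ler_wpM2l//.
  exact: (ler_normD (h1 j k : RC) (h2 j k)).
by apply: leeD; apply: ereal_sup_ubound; exists j => //; exists k.
Qed.

Let wsup_bound h : (wsup h < +oo)%E ->
  exists M, forall j k, A j -> B k -> w j k * normc (h j k) <= M.
Proof.
case E : (wsup h) => [r| |] // _.
- exists r => j k Aj Bk; rewrite -lee_fin -E.
  by apply: ereal_sup_ubound; exists j => //; exists k.
- exists 0 => j k Aj Bk.
  have : (wsup h <= -oo)%E by rewrite E.
  move=> /(le_trans (ereal_sup_ubound _)) => /(_ (w j k * normc (h j k))%:E).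
  rewrite leeNy_eq => H.
  by have := H (ex_intro2 _ _ j Aj (ex_intro2 _ _ k Bk erefl)).
Qed.

Lemma wsup_lincomb (a : C) h h1 h2 :
  (forall j k, h j k = a * h1 j k + h2 j k) ->
  (wsup h1 < +oo)%E -> (wsup h2 < +oo)%E -> (wsup h < +oo)%E.
Proof.
move=> hE /wsup_bound[M1 hM1] /wsup_bound[M2 hM2].
apply: (@le_lt_trans _ _ (normc a * M1 + M2)%:E); last exact: ltry.
apply: ge_ereal_sup => _ [j Aj [k Bk <-]]; rewrite hE lee_fin.
apply: (@le_trans _ _ (normc a * (w j k * normc (h1 j k)) + w j k * normc (h2 j k))).
  rewrite mulrCA -mulrDr ler_wpM2l// -normcM.
  exact: (ler_normD (a * h1 j k : RC) (h2 j k)).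
rewrite lerD ?hM2// ler_wpM2l ?hM1//.
exact: (normr_ge0 (a : RC)).
Qed.

End wsup.

End complex_valued.

(* The norm of the library on ['rV[R]_n] is the sup norm; the norms entering
   the seminorms and the sphere are the Euclidean ones. *)
Definition enorm (R : realType) n (t : 'rV[R]_n) : R :=
  Num.sqrt (\sum_i t 0 i ^+ 2).

Definition dotr (R : realType) n (s t : 'rV[R]_n) : R :=
  \sum_i s 0 i * t 0 i.

Section K1_space.
Context {R : realType} {n : nat}.
Local Notation C := R[i].
Local Notation RC := (Rcomplex R).
Implicit Types (f g : 'rV[R]_n -> C) (k : nat).

Definition pd (i : 'I_n) f : 'rV[R]_n -> C :=
  fun t => 'D_(delta_mx 0 i) (f : 'rV[R]_n -> RC) t.

Definition pds (s : seq 'I_n) f : 'rV[R]_n -> C := foldr pd f s.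

(* All iterated partial derivatives, in any order, exist and are continuous. *)
Definition Cinfty f := forall s : seq 'I_n,
  continuous (pds s f : 'rV[R]_n -> RC) /\
  forall i t, derivable (pds s f : 'rV[R]_n -> RC) t (delta_mx 0 i).

Definition pdm (alpha : 'I_n -> nat) f : 'rV[R]_n -> C :=
  pds (flatten [seq nseq (alpha i) i | i <- enum 'I_n]) f.

Definition rho k f : \bar R := ereal_sup
  [set (expR (k%:R * enorm t) * normc (pdm alpha f t))%:E
    | t in [set: 'rV[R]_n]
    & alpha in [set alpha : 'I_n -> nat | (\sum_i alpha i <= k)%N]].

Definition K1_pred : {pred 'rV[R]_n -> C} :=
  [pred f | `[< Cinfty f /\ forall k, (rho k f < +oo)%E >]].

Lemma pds_lincomb (a : C) f g : Cinfty f -> Cinfty g ->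
  forall s, pds s (a *: f + g) = a *: pds s f + pds s g.
Proof.
move=> cf cg; elim=> [//|i s IHs] /=; rewrite IHs.
apply/funext => t; rewrite /pd derive_lincomb//.
- exact: (cf s).2.
- exact: (cg s).2.
Qed.

Lemma Cinfty_lincomb (a : C) f g : Cinfty f -> Cinfty g ->
  Cinfty (a *: f + g).
Proof.
move=> cf cg s; rewrite pds_lincomb//; split=> [t|i t].
- have ct := cvg_mulC (a := a) (FF := nbhs_filter t) ((cf s).1 t).
  exact: cvgD ct ((cg s).1 t).
- by apply: derivable_lincomb; [exact: (cf s).2|exact: (cg s).2].
Qed.

Lemma pds_cst0 s : pds s 0 = 0.
Proof.
elim: s => [//|i s /= ->]; apply/funext => t.
exact: (@derive_cst R 'rV[R]_n RC (0 : RC) t (delta_mx 0 i)).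
Qed.

Lemma Cinfty0 : Cinfty 0.
Proof.
move=> s; rewrite pds_cst0; split=> [t|i t].
- exact: (@cst_continuous 'rV[R]_n RC 0).
- exact: (@derivable_cst R 'rV[R]_n RC (0 : RC)).
Qed.

Lemma rho0 k : (rho k 0%R <= 0)%E.
Proof. by apply: wsup0 => t alpha; rewrite /pdm pds_cst0. Qed.

Lemma rhoD k f g : Cinfty f -> Cinfty g ->
  (rho k (f + g)%R <= rho k f + rho k g)%E.
Proof.
move=> cf cg; apply: wsupD => [t alpha|t alpha]; first exact: expR_ge0.
by rewrite /pdm -[f in pds _ (f + g)]scale1r pds_lincomb// scale1r.
Qed.

Lemma K1_submod_closed : submod_closed K1_pred.
Proof.
split=> [|a f g].
- apply/asboolP; split=> [|k]; first exact: Cinfty0.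
  exact: le_lt_trans (rho0 k) (ltry _).
- move=> /asboolP[cf fk] /asboolP[cg gk]; apply/asboolP; split=> [|k].
    exact: Cinfty_lincomb.
  apply: wsup_lincomb (fk k) (gk k) => [t alpha|t alpha]; first exact: expR_ge0.
  by rewrite /pdm pds_lincomb.
Qed.

HB.instance Definition _ :=
  GRing.isSubmodClosed.Build C ('rV[R]_n -> C) K1_pred K1_submod_closed.

End K1_space.

(* K_1(R^n); K_1(R) is [K1 R 1], with R identified with ['rV[R]_1]. *)
Record K1 (R : realType) (n : nat) := MkK1 {
  K1_val :> 'rV[R]_n -> R[i];
  K1_valP : K1_val \in K1_pred }.

Section K1_structure.
Variables (R : realType) (n : nat).

HB.instance Definition _ := [isSub for @K1_val R n].
HB.instance Definition _ := [Choice of K1 R n by <:].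
HB.instance Definition _ := [SubChoice_isSubLmodule of K1 R n by <:].

Let p (k : nat) (f : K1 R n) := rho k f.

Let p0 k : (p k 0%R <= 0)%E. Proof. exact: rho0. Qed.

Let pD k (f g : K1 R n) : (p k (f + g)%R <= p k f + p k g)%E.
Proof.
have /asboolP[cf _] := K1_valP f; have /asboolP[cg _] := K1_valP g.
exact: rhoD.
Qed.

HB.instance Definition _ := hasNbhs.Build (K1 R n) (seminorm_nbhs p).
HB.instance Definition _ := Nbhs_isNbhsTopological.Build (K1 R n)
  (seminorm_nbhs_filter p0) (seminorm_nbhs_singleton p0)
  (seminorm_nbhs_nbhs pD).

End K1_structure.

Section KU_space.
Context {R : realType} {n : nat}.
Local Notation C := R[i].
Local Notation RC := (Rcomplex R).
Implicit Types (Phi Psi : R -> 'rV[C]_n -> C) (k l : nat).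

Definition cnorm (z : 'rV[C]_n) : R := Num.sqrt (\sum_i normc (z 0 i) ^+ 2).

Definition entire (f : 'rV[C]_n -> C) :=
  forall z, differentiable (f : 'rV[C]_n -> C^o) z.

Definition tube k : set 'rV[C]_n :=
  [set z | forall i, `|complex.Im (z 0 i)| <= k%:R].

Definition pdx l Phi (x : R) (z : 'rV[C]_n) : C :=
  derive1n l (fun y => Phi y z : RC) x.

Definition smooth_entire Phi :=
  (forall z l x, derivable (fun y => pdx l Phi y z : RC) x 1) /\
  (forall x, entire (Phi x)).

Definition rhoKU (kl : nat * nat) Phi : \bar R := ereal_sup
  [set (expR (kl.1%:R * `|x|) * (1 + cnorm z ^+ 2) `^ (kl.1%:R / 2)
        * normc (pdx kl.2 Phi x z))%:E
    | x in [set: R] & z in tube kl.1].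

Definition KU_pred : {pred R -> 'rV[C]_n -> C} :=
  [pred Phi | `[< smooth_entire Phi /\
                  forall kl, (rhoKU kl Phi < +oo)%E >]].

Lemma pdx_lincomb (a : C) Phi Psi : smooth_entire Phi -> smooth_entire Psi ->
  forall l x z, pdx l (a *: Phi + Psi) x z = a * pdx l Phi x z + pdx l Psi x z.
Proof.
move=> [sPhi _] [sPsi _] l x z; elim: l x => [//|l IHl] x.
rewrite /pdx /= !derive1E.
have -> : derive1n l (fun y => (a *: Phi + Psi) y z : RC) =
          (a *: (fun y => pdx l Phi y z) + (fun y => pdx l Psi y z) : R -> C).
  by apply/funext => y; exact: IHl.
exact: (derive_lincomb _ (sPhi z l x) (sPsi z l x)).
Qed.

Lemma smooth_entire_lincomb (a : C) Phi Psi :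
  smooth_entire Phi -> smooth_entire Psi -> smooth_entire (a *: Phi + Psi).
Proof.
move=> sPhi sPsi; split=> [z l x|x z].
- have -> : (fun y => pdx l (a *: Phi + Psi) y z : RC) =
      (a *: (fun y => pdx l Phi y z) + (fun y => pdx l Psi y z) : R -> C).
    by apply/funext => y; exact: pdx_lincomb.
  exact: derivable_lincomb (sPhi.1 z l x) (sPsi.1 z l x).
- exact: (differentiableD (differentiableZ a (sPhi.2 x z)) (sPsi.2 x z)).
Qed.

Lemma pdx_cst0 l x z : pdx l 0 x z = 0.
Proof.
elim: l x => [//|l IHl] x; rewrite /pdx /= derive1E.
have -> : derive1n l (fun y => (0 : R -> 'rV[C]_n -> C) y z : RC) = cst (0 : RC).
  by apply/funext => y; exact: IHl.
exact: (@derive_cst R R RC (0 : RC) x 1).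
Qed.

Lemma smooth_entire0 : smooth_entire 0.
Proof.
split=> [z l x|x z].
- have -> : (fun y => pdx l 0 y z : RC) = cst (0 : RC).
    by apply/funext => y; exact: pdx_cst0.
  exact: (@derivable_cst R R RC (0 : RC)).
- exact: (@differentiable_cst C 'rV[C]_n C^o (0 : C^o)).
Qed.

Lemma rhoKU0 kl : (rhoKU kl 0%R <= 0)%E.
Proof. by apply: wsup0 => x z; rewrite pdx_cst0. Qed.

Lemma rhoKU_weight_ge0 k (x : R) (z : 'rV[C]_n) :
  0 <= expR (k%:R * `|x|) * (1 + cnorm z ^+ 2) `^ (k%:R / 2).
Proof. by rewrite mulr_ge0 ?expR_ge0 ?powR_ge0. Qed.

Lemma rhoKUD kl Phi Psi : smooth_entire Phi -> smooth_entire Psi ->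
  (rhoKU kl (Phi + Psi)%R <= rhoKU kl Phi + rhoKU kl Psi)%E.
Proof.
move=> sPhi sPsi; apply: wsupD => [x z|x z]; first exact: rhoKU_weight_ge0.
by rewrite -[Phi in pdx _ (Phi + Psi)]scale1r pdx_lincomb// mul1r.
Qed.

Lemma KU_submod_closed : submod_closed KU_pred.
Proof.
split=> [|a Phi Psi].
- apply/asboolP; split=> [|kl]; first exact: smooth_entire0.
  exact: le_lt_trans (rhoKU0 kl) (ltry _).
- move=> /asboolP[sPhi fPhi] /asboolP[sPsi fPsi]; apply/asboolP; split=> [|kl].
    exact: smooth_entire_lincomb.
  apply: wsup_lincomb (fPhi kl) (fPsi kl) => [x z|x z].
    exact: rhoKU_weight_ge0.
  exact: pdx_lincomb.
Qed.

HB.instance Definition _ :=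
  GRing.isSubmodClosed.Build C (R -> 'rV[C]_n -> C) KU_pred KU_submod_closed.

End KU_space.

(* The completed tensor product of K_1(R) and U(C^n), realized as the space of
   functions of (x, z), smooth in x and entire in z, for which all the norms
   [rhoKU (k, l)] are finite, with the topology of these norms. *)
Record KU (R : realType) (n : nat) := MkKU {
  KU_val :> R -> 'rV[R[i]]_n -> R[i];
  KU_valP : KU_val \in KU_pred }.

Section KU_structure.
Variables (R : realType) (n : nat).

HB.instance Definition _ := [isSub for @KU_val R n].
HB.instance Definition _ := [Choice of KU R n by <:].
HB.instance Definition _ := [SubChoice_isSubLmodule of KU R n by <:].

Let p (kl : nat * nat) (Phi : KU R n) := rhoKU kl Phi.

Let p0 kl : (p kl 0%R <= 0)%E. Proof. exact: rhoKU0. Qed.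

Let pD kl (Phi Psi : KU R n) : (p kl (Phi + Psi)%R <= p kl Phi + p kl Psi)%E.
Proof.
have /asboolP[cPhi _] := KU_valP Phi; have /asboolP[cPsi _] := KU_valP Psi.
exact: rhoKUD.
Qed.

HB.instance Definition _ := hasNbhs.Build (KU R n) (seminorm_nbhs p).
HB.instance Definition _ := Nbhs_isNbhsTopological.Build (KU R n)
  (seminorm_nbhs_filter p0) (seminorm_nbhs_singleton p0)
  (seminorm_nbhs_nbhs pD).

End KU_structure.

(* Lebesgue measure on R^n, carried by the measurable type of n-tuples: the
   image of the product of the measures on R and R^(n-1). *)
Section lebesgue_tuple.
Variable R : realType.
Local Notation mR := (measurableTypeR R).

Section lebesgue_cons.
Variables (n : nat) (mu : {sigma_finite_measure set (n.-tuple mR) -> \bar R}).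

Definition lebesgue_cons : set (n.+1.-tuple mR) -> \bar R :=
  pushforward (@lebesgue_measure R \x mu)%E
    (fun p : mR * n.-tuple mR => [tuple of p.1 :: p.2]).

Let mcons : measurable_fun setT
  (fun p : mR * n.-tuple mR => [tuple of p.1 :: p.2]).
Proof. exact: measurable_cons. Qed.

Let lebesgue_cons0 : lebesgue_cons set0 = 0%E.
Proof. exact: measure0. Qed.

Let lebesgue_cons_ge0 A : (0 <= lebesgue_cons A)%E.
Proof. exact: measure_ge0. Qed.

Let lebesgue_cons_sigma_additive : semi_sigma_additive lebesgue_cons.
Proof. exact: measure_semi_sigma_additive. Qed.

HB.instance Definition _ := isMeasure.Build _ _ _ lebesgue_cons
  lebesgue_cons0 lebesgue_cons_ge0 lebesgue_cons_sigma_additive.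

Let lebesgue_cons_sigma_finite : sigma_finite setT lebesgue_cons.
Proof.
have /sigma_finiteP[F [TF ndF Foo]] := sigma_finiteT (@lebesgue_measure R).
have /sigma_finiteP[G [TG ndG Goo]] := sigma_finiteT mu.
pose tailp (t : n.+1.-tuple mR) : mR * n.-tuple mR := (thead t, [tuple of behead t]).
have mtailp : measurable_fun setT tailp.
  apply/measurable_fun_pairP; split; first exact: measurable_tnth.
  exact: measurable_behead.
have tailK (p : mR * n.-tuple mR) : tailp [tuple of p.1 :: p.2] = p.
  by case: p => x t; congr pair; apply/val_inj.
exists (fun k => tailp @^-1` (F k `*` G k)).
  apply/seteqP; split=> // t _.
  have [i _ Fi] : (\bigcup_i F i) (tailp t).1 by rewrite -TF.
  have [j _ Gj] : (\bigcup_j G j) (tailp t).2 by rewrite -TG.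
  exists (maxn i j) => //; split.
    by move: Fi; exact/subsetPset/ndF/leq_maxl.
  by move: Gj; exact/subsetPset/ndG/leq_maxr.
move=> k; have [mFk Fk] := Foo k; have [mGk Gk] := Goo k; split.
  by rewrite -[X in measurable X]setTI; apply: mtailp => //; exact: measurableX.
rewrite /lebesgue_cons /pushforward [X in (_ X < _)%E](_ : _ = F k `*` G k).
  by rewrite product_measure1E// lte_mul_pinfty// ge0_fin_numE.
apply/funext => p; rewrite /preimage /mkset; congr ((_ `*` _) _).
exact: tailK.
Qed.

HB.instance Definition _ :=
  Measure_isSigmaFinite.Build _ _ _ lebesgue_cons lebesgue_cons_sigma_finite.

End lebesgue_cons.

Fixpoint lebesgue_tuple n :
    {sigma_finite_measure set (n.-tuple mR) -> \bar R} :=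
  if n is m.+1 then lebesgue_cons (lebesgue_tuple m)
  else dirac [tuple of [::]].

End lebesgue_tuple.

Section complex_integral.
Context {R : realType} {d : measure_display} {T : measurableType d}.
Variable mu : {measure set T -> \bar R}.

Definition cintegrable (f : T -> R[i]) : Prop :=
  mu.-integrable setT (fun x => (complex.Re (f x))%:E) /\
  mu.-integrable setT (fun x => (complex.Im (f x))%:E).

Definition cintegral (f : T -> R[i]) : R[i] :=
  Rintegral mu setT (fun x => complex.Re (f x))
  +i* Rintegral mu setT (fun x => complex.Im (f x)).

End complex_integral.

Definition expi (R : realType) (x : R) : R[i] := cos x +i* sin x.

Section DS_adjoint.
Context {R : realType} {n : nat}.
Local Notation mR := (measurableTypeR R).
Variables (g : 'rV[R]_1 -> R[i]) (u : 'rV[R]_n).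
Variables (Phi : R -> 'rV[R[i]]_n -> R[i]) (t : 'rV[R]_n).

Definition DSadj_integrand (xi : n.-tuple mR) (x : mR) : R[i] :=
  Phi x (\row_j (tnth xi j)%:C) * g (const_mx (dotr u t - x))
  * expi (2 * pi * dotr (\row_j tnth xi j) t).

Definition DSadj_inner (xi : n.-tuple mR) : R[i] :=
  cintegral (@lebesgue_measure R) (DSadj_integrand xi).

Definition DSadj_integrable : Prop :=
  (forall xi, cintegrable (@lebesgue_measure R) (DSadj_integrand xi)) /\
  cintegrable (@lebesgue_tuple R n) DSadj_inner.

Definition DSadj : R[i] := cintegral (@lebesgue_tuple R n) DSadj_inner.

End DS_adjoint.

(* Main.v *)
Require Import Defs.
From HB Require Import structures.
From mathcomp Require Import all_boot all_order all_algebra.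
From mathcomp Require Import all_classical all_reals all_analysis.
From mathcomp.real_closed Require Import complex.
From mathcomp Require Import measurable_realfun ring lra.

Set Implicit Arguments.
Unset Strict Implicit.
Unset Printing Implicit Defensive.

Import Order.TTheory GRing.Theory Num.Theory.
Import numFieldNormedType.Exports.
Import Normc.

Local Open Scope classical_set_scope.
Local Open Scope ring_scope.
Local Open Scope complex_scope.

(** Write DS(Phi, g) for the transform.  It is an absolutely convergent
    integral over (x, xi) in R^(1+n), because Phi decays so fast that its
    integrand is bounded by the supremum of |g| times a multiple of the
    integrable weight 1/(1+x^2) * prod_i 1/(1+xi_i^2).  All estimates below are
    dominations by this weight.

    Exponential decay in t comes from Cauchy's theorem.  The symbol is entire
    and small in tubes, so the line of integration of a single variable xi_j
    may be moved to height eta, which gives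
      DS(Phi, g)(t) = exp(-2 pi eta t_j) DS(Phi(., . + i eta e_j), g)(t)
    ([DSadj_shift]).  With j such that |t_j| is maximal and eta = n k or - n k,
    of the sign of t_j, the exponential beats exp(k|t|), and exp(k|t|)
    |DS(Phi, g)(t)| is at most a constant times a norm of Phi times sup |g|
    ([DSadj_decay]).  The complex derivatives of an entire function are not
    known beforehand to be continuous, so Cauchy's theorem is proved by
    Goursat's bisection, for closed differential forms in the plane
    ([goursat]); rectangles that grow to a strip give [strip_shift].

    For derivatives, the transform reproduces itself:
      d_v DS(Phi, g) = <u, v> DS(Phi, g') + DS(2 pi i <v, z> Phi, g)
    ([DSadj_is_derive]).  The pointwise Taylor remainder of the integrand is
    bounded by h^2 times the weight, uniformly in t, since the second
    derivative of the integrand is again a combination of integrands of the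
    same kind; integrating this bound gives the formula.  Iterating it, every
    partial derivative of DS(Phi, g) is a sum of transforms of polynomial
    multiples of Phi and derivatives of g ([pds_DSadj]), to which the decay
    estimate applies.  The result is
      rho_k(DS(Phi, g)) <= K rho_(k0)^0(Phi) rho_k(g)
    ([rho_DSadj_le]), which is continuity for a bilinear map. *)

(** * Dominated integrals on R^n *)

Lemma integrable_dominated (d : measure_display) (T : measurableType d)
    (R : realType) (m : {measure set T -> \bar R}) (w F : T -> R) (A : R) :
  m.-integrable setT (EFin \o w) -> measurable_fun setT F ->
  (forall x, `|F x| <= A * w x) -> m.-integrable setT (EFin \o F).
Proof.
move=> iw mF FA.
apply: (le_integrable measurableT _ _ (integrableZl measurableT A iw)).
  exact/measurable_EFinP.
move=> x _ /=; rewrite lee_fin (le_trans (FA x))//.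
exact: ler_norm.
Qed.

Lemma normr_Rintegral_dominated (d : measure_display) (T : measurableType d)
    (R : realType) (m : {measure set T -> \bar R}) (w F : T -> R) (A : R) :
  m.-integrable setT (EFin \o w) -> measurable_fun setT F ->
  (forall x, `|F x| <= A * w x) -> `|Rintegral m setT F| <= A * Rintegral m setT w.
Proof.
move=> iw mF FA; have iF := integrable_dominated iw mF FA.
rewrite -RintegralZl//; apply: le_trans (le_normr_Rintegral measurableT iF) _.
apply: le_Rintegral => //.
- apply: (integrable_dominated (w := w) (A := A)) => //.
    exact: measurableT_comp.
  by move=> x; rewrite normr_id.
- exact: (integrableZl measurableT A iw).
Qed.

Section dominated_product.
Context d1 d2 (T1 : measurableType d1) (T2 : measurableType d2) (R : realType).
Variable m1 : {sigma_finite_measure set T1 -> \bar R}.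
Variable m2 : {sigma_finite_measure set T2 -> \bar R}.
Variables (w1 : T1 -> R) (w2 : T2 -> R).
Hypothesis w10 : forall x, 0 <= w1 x.
Hypothesis w20 : forall y, 0 <= w2 y.
Hypothesis iw1 : m1.-integrable setT (EFin \o w1).
Hypothesis iw2 : m2.-integrable setT (EFin \o w2).

Let mw1 : measurable_fun setT w1.
Proof. exact/measurable_EFinP/(measurable_int m1 iw1). Qed.
Let mw2 : measurable_fun setT w2.
Proof. exact/measurable_EFinP/(measurable_int m2 iw2). Qed.

Lemma integrable_product_weight :
  (m1 \x m2)%E.-integrable setT (EFin \o (fun z => w1 z.1 * w2 z.2)).
Proof.
apply/integrable12ltyP.
  apply/measurable_EFinP; apply: measurable_funM.
    exact: measurableT_comp mw1 measurable_fst.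
  exact: measurableT_comp mw2 measurable_snd.
have /integrableP[_] := integrableZr measurableT (Rintegral m2 setT w2) iw1.
apply: le_lt_trans; rewrite le_eqVlt; apply/orP; left; apply/eqP.
apply: eq_integral => x _ /=.
under eq_integral => y _.
  rewrite /= ger0_norm ?mulr_ge0// EFinM.
  over.
rewrite ge0_integralZl//=; last 3 first.
- exact/measurable_EFinP.
- by move=> y _; rewrite lee_fin.
- by rewrite lee_fin.
rewrite ger0_norm ?mulr_ge0 ?Rintegral_ge0// [RHS]EFinM /Rintegral fineK//.
exact: integrable_fin_num iw2.
Qed.

Variables (F : T1 * T2 -> R) (A : R).
Hypothesis mF : measurable_fun setT F.
Hypothesis FA : forall x y, `|F (x, y)| <= A * (w1 x * w2 y).

Let iF : (m1 \x m2)%E.-integrable setT (EFin \o F).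
Proof.
apply: integrable_dominated integrable_product_weight mF _ => -[x y].
exact: FA.
Qed.

Let F1 x y : `|F (x, y)| <= (A * w1 x) * w2 y.
Proof. by rewrite -mulrA. Qed.
Let F2 x y : `|F (x, y)| <= (A * w2 y) * w1 x.
Proof. by rewrite -mulrA [w2 y * _]mulrC. Qed.
Let mF1 x : measurable_fun setT (fun y => F (x, y)).
Proof. exact: measurableT_comp. Qed.
Let mF2 y : measurable_fun setT (fun x => F (x, y)).
Proof. exact: measurableT_comp. Qed.

Let i1 x : m2.-integrable setT (EFin \o (fun y => F (x, y))).
Proof. exact: integrable_dominated iw2 (mF1 x) (F1 x). Qed.
Let i2 y : m1.-integrable setT (EFin \o (fun x => F (x, y))).
Proof. exact: integrable_dominated iw1 (mF2 y) (F2^~ y). Qed.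

Let E1 x : (\int[m2]_y (F (x, y))%:E = (Rintegral m2 setT (fun y => F (x, y)))%:E)%E.
Proof. by rewrite /Rintegral fineK//; exact: integrable_fin_num (i1 x). Qed.
Let E2 y : (\int[m1]_x (F (x, y))%:E = (Rintegral m1 setT (fun x => F (x, y)))%:E)%E.
Proof. by rewrite /Rintegral fineK//; exact: integrable_fin_num (i2 y). Qed.

Lemma measurable_Rintegral2 :
  measurable_fun setT (fun y => Rintegral m1 setT (fun x => F (x, y))).
Proof.
apply/measurable_EFinP; have := measurable_fubini_G iF.
by apply: eq_measurable_fun => x _; exact: E2.
Qed.

Lemma normr_Rintegral2 y : `|Rintegral m1 setT (fun x => F (x, y))| <=
  (A * Rintegral m1 setT w1) * w2 y.
Proof. by rewrite mulrAC; exact: normr_Rintegral_dominated. Qed.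

Lemma Rintegral12 : Rintegral (m1 \x m2)%E setT F =
  Rintegral m1 setT (fun x => Rintegral m2 setT (fun y => F (x, y))).
Proof.
rewrite /Rintegral -(integral12_prod_meas1 iF); congr fine.
by apply: eq_integral => x _; exact: E1.
Qed.

Lemma Rintegral21 : Rintegral (m1 \x m2)%E setT F =
  Rintegral m2 setT (fun y => Rintegral m1 setT (fun x => F (x, y))).
Proof.
rewrite /Rintegral -(integral21_prod_meas1 iF); congr fine.
by apply: eq_integral => x _; exact: E2.
Qed.

End dominated_product.

Section tuple_integrals.
Variable R : realType.
Local Notation mR := (measurableTypeR R).
Local Notation leb := (@lebesgue_measure R).
Local Notation lebn := (@lebesgue_tuple R).

Definition weight1 (x : mR) : R := (oneDsqr x)^-1.

Lemma weight1_gt0 x : 0 < weight1 x.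
Proof. by rewrite invr_gt0 (lt_le_trans ltr01). Qed.

Lemma weight1_le1 x : weight1 x <= 1.
Proof. exact: oneDsqrV_le1. Qed.

Lemma integrable_weight1 : leb.-integrable setT (EFin \o weight1).
Proof.
have cw : continuous weight1 by exact: continuous_oneDsqrV.
apply/integrableP; split.
  by apply/measurable_EFinP; exact: continuous_measurable_fun.
under eq_integral do rewrite /= ger0_norm ?(ltW (weight1_gt0 _))//.
rewrite ge0_symfun_integralT//.
- by rewrite -set_itvcy integral0y_oneDsqr -EFinM ltry.
- by move=> x; exact/ltW/weight1_gt0.
- by move=> x; rewrite /weight1 /= /oneDsqr sqrrN.
Qed.

(** The weight factors along the head and tail of a tuple, which makes
    induction on the dimension possible. *)
Definition weight n (t : n.-tuple mR) : R := \prod_i weight1 (tnth t i).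

Lemma weight_gt0 n (t : n.-tuple mR) : 0 < weight t.
Proof. by apply: prodr_gt0 => i _; exact: weight1_gt0. Qed.

Lemma weight_cons n x (t : n.-tuple mR) :
  weight [tuple of x :: t] = weight1 x * weight t.
Proof.
rewrite /weight big_ord_recl; congr (_ * _).
by apply: eq_bigr => i _; rewrite tnthS.
Qed.

Let measurable_consp n :
  measurable_fun setT (fun p : mR * n.-tuple mR => [tuple of p.1 :: p.2]).
Proof. exact: measurable_cons. Qed.

Lemma integrable_weight n : (lebn n).-integrable setT (EFin \o @weight n).
Proof.
elim: n => [|n IHn].
  rewrite (_ : _ \o _ = cst 1%E); last first.
    by apply/funext => t; rewrite /= /weight big_ord0.
  apply/integrableP; split; first exact: measurable_cst.
  rewrite (_ : (fun x => _) = cst 1%E); last by apply/funext => x /=; rewrite normr1.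
  by rewrite integral_cst// mul1e /= diracT ltry.
have ip := integrable_product_weight (fun x => ltW (weight1_gt0 x))
  (fun t => ltW (weight_gt0 t)) integrable_weight1 IHn.
apply: integrable_pushforward => //.
- exact: measurable_consp.
- apply/measurable_EFinP; apply: measurable_prod => i _.
  apply: (measurableT_comp (f := weight1)).
    exact: (measurable_EFinP _ _).1 (measurable_int _ integrable_weight1).
  exact: measurable_tnth.
- rewrite preimage_setT; apply: eq_integrable ip => // -[x t] _ /=.
  by rewrite weight_cons.
Qed.

(** Domination by the weight, in contrast to integrability, passes to every
    section of F and not only to almost every one. *)
Definition tame n (F : n.-tuple mR -> R) :=
  measurable_fun setT F /\ exists A, forall t, `|F t| <= A * weight t.

Lemma tame_integrable n (F : n.-tuple mR -> R) :
  tame F -> (lebn n).-integrable setT (EFin \o F).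
Proof.
by move=> [mF [A FA]]; exact: integrable_dominated (integrable_weight n) mF FA.
Qed.

Section fubini_cons.
Variables (n : nat) (F : n.+1.-tuple mR -> R) (A : R).
Hypothesis mF : measurable_fun setT F.
Hypothesis FA : forall t, `|F t| <= A * weight t.

Let G (p : mR * n.-tuple mR) := F [tuple of p.1 :: p.2].
Let mG : measurable_fun setT G.
Proof. exact: (measurableT_comp mF (@measurable_consp n)). Qed.
Let GA x t : `|G (x, t)| <= A * (weight1 x * weight t).
Proof. by rewrite -weight_cons; exact: FA. Qed.
Let w1 := fun x : mR => ltW (weight1_gt0 x).
Let w2 := fun t : n.-tuple mR => ltW (weight_gt0 t).

Let Rintegral_consE : Rintegral (lebn n.+1) setT F = Rintegral (leb \x lebn n)%E setT G.
Proof.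
rewrite /Rintegral integral_pushforward//.
- exact: measurable_consp.
- exact/measurable_EFinP.
- rewrite preimage_setT; apply: integrable_dominated mG _.
    exact: integrable_product_weight w1 w2 integrable_weight1 (integrable_weight n).
  by move=> -[x t]; exact: GA.
Qed.

Lemma tame_section x : tame (fun t => F [tuple of x :: t]).
Proof.
split; last by exists (A * weight1 x) => t; rewrite -mulrA -weight_cons.
exact: (measurableT_comp mG (measurable_pair1 x)).
Qed.

Lemma measurable_head_section (t : n.-tuple mR) :
  measurable_fun setT (fun x : mR => F [tuple of x :: t]).
Proof. exact: (measurableT_comp mG (measurable_pair2 t)). Qed.

Lemma integrable_head_section (t : n.-tuple mR) :
  leb.-integrable setT (EFin \o (fun x => F [tuple of x :: t])).
Proof.
apply: (integrable_dominated (A := A * weight t) integrable_weight1).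
  exact: measurable_head_section.
by move=> x; rewrite -mulrA [weight t * _]mulrC -weight_cons.
Qed.

Lemma tame_integral_head :
  tame (fun t => Rintegral leb setT (fun x => F [tuple of x :: t])).
Proof.
split; first exact: (measurable_Rintegral2 w1 w2 integrable_weight1 (integrable_weight n) mG GA).
exists (A * Rintegral leb setT weight1).
by move=> t; exact: (normr_Rintegral2 integrable_weight1 mG GA).
Qed.

Lemma Rintegral_cons_head : Rintegral (lebn n.+1) setT F =
  Rintegral (lebn n) setT (fun t => Rintegral leb setT (fun x => F [tuple of x :: t])).
Proof. by rewrite Rintegral_consE (Rintegral21 w1 w2 integrable_weight1 (integrable_weight n) mG GA). Qed.

Lemma Rintegral_cons_tail : Rintegral (lebn n.+1) setT F =
  Rintegral leb setT (fun x => Rintegral (lebn n) setT (fun t => F [tuple of x :: t])).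
Proof. by rewrite Rintegral_consE (Rintegral12 w1 w2 integrable_weight1 (integrable_weight n) mG GA). Qed.

End fubini_cons.

Definition upd n (t : n.-tuple mR) (j : 'I_n) (s : mR) : n.-tuple mR :=
  [tuple if i == j then s else tnth t i | i < n].

Lemma tnth_upd n (t : n.-tuple mR) j s i :
  tnth (upd t j s) i = if i == j then s else tnth t i.
Proof. by rewrite tnth_mktuple. Qed.

Lemma upd_cons0 n x s (t : n.-tuple mR) :
  upd [tuple of x :: t] ord0 s = [tuple of s :: t].
Proof.
apply: eq_from_tnth => i; rewrite tnth_upd.
by case: (unliftP ord0 i) => [k|] -> //=; rewrite !tnthS.
Qed.

Lemma upd_consS n x s (t : n.-tuple mR) j :
  upd [tuple of x :: t] (lift ord0 j) s = [tuple of x :: upd t j s].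
Proof.
apply: eq_from_tnth => i; rewrite tnth_upd.
case: (unliftP ord0 i) => [k|] -> //=.
by rewrite !tnthS (inj_eq lift_inj) tnth_upd.
Qed.

(** Fubini's theorem brings the integration over the j-th coordinate
    innermost; the induction peels off the coordinates before it, one by
    one. *)
Lemma Rintegral_slice0 n (F : n.-tuple mR -> R) (j : 'I_n) : tame F ->
  (forall t, Rintegral leb setT (fun s => F (upd t j s)) = 0) ->
  Rintegral (lebn n) setT F = 0.
Proof.
elim: n F j => [F [[]]//|n IHn] F j [mF [A FA]] F0.
case: (unliftP ord0 j) => [k jk|j0].
  rewrite (Rintegral_cons_tail mF FA).
  rewrite (eq_Rintegral _ (g := fun=> 0)) ?Rintegral_cst ?mul0r// => x _.
  rewrite (IHn _ k (tame_section mF FA x))// => t.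
  by rewrite -[RHS](F0 [tuple of x :: t]) jk; under [RHS]eq_Rintegral do rewrite upd_consS.
rewrite (Rintegral_cons_head mF FA).
rewrite (eq_Rintegral _ (g := fun=> 0)) ?Rintegral_cst ?mul0r// => t _.
by rewrite -[RHS](F0 [tuple of 0 :: t]) j0; under [RHS]eq_Rintegral do rewrite upd_cons0.
Qed.

Lemma tameB n (F G : n.-tuple mR -> R) : tame F -> tame G -> tame (F \- G).
Proof.
move=> [mF [A FA]] [mG [B GB]]; split; first exact: measurable_funB.
exists (A + B) => t; rewrite mulrDl (le_trans (ler_normB _ _))//.
exact: lerD.
Qed.

End tuple_integrals.

(** * Measurability of separately continuous functions *)

(** Any function of a countably-valued map with measurable fibres is
    measurable, whatever its regularity. *)
Lemma measurable_countable_limit (d : measure_display) (T : measurableType d)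
    (R : realType) (K : countType) (q : nat -> T -> K) (f : nat -> K -> R)
    (F : T -> R) :
  (forall m k, measurable (q m @^-1` [set k])) ->
  (forall t, f m (q m t) @[m --> \oo] --> F t) -> measurable_fun setT F.
Proof.
move=> mq fF; apply: (measurable_fun_cvg (h := fun m t => f m (q m t))) => [m|t _];
  last exact: fF.
move=> _ Y _; rewrite setTI.
rewrite [X in measurable X](_ : _ = \bigcup_i
    (if unpickle i is Some k then
       (if `[< Y (f m k) >] then q m @^-1` [set k] else set0) else set0)).
  apply: bigcup_measurable => i _; case: unpickle => [k|] //.
  by case: ifP => _.
apply/seteqP; split=> [t Yt|t [i _]].
  exists (pickle (q m t)) => //; rewrite pickleK.
  by case: asboolP.
case: unpickle => [k|] //; case: asboolP => // Yk; rewrite /preimage /= => ->; exact: Yk.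
Qed.

Section grid.
Variable R : realType.
Local Notation mR := (measurableTypeR R).

Definition grid_idx (m : nat) (x : R) : int := Num.floor (m.+1%:R * x).
Definition grid_pt (m : nat) (k : int) : R := k%:~R / m.+1%:R.

Lemma grid_dist m x : `|x - grid_pt m (grid_idx m x)| <= m.+1%:R^-1.
Proof.
have m0 : 0 < m.+1%:R :> R by rewrite ltr0n.
rewrite -(ler_pM2l m0) divff ?gt_eqF// -[X in X * _](gtr0_norm m0) -normrM.
rewrite mulrBr /grid_pt mulrCA divff ?gt_eqF// mulr1 ger0_norm ?subr_ge0 ?floor_le_tmp//.
by rewrite lerBlDl ltW// -[X in _ + X](mulr1z (1 : R)) -intrD floorD1_gt// num_real.
Qed.

Lemma grid_cvg x : grid_pt m (grid_idx m x) @[m --> \oo] --> x.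
Proof.
apply/cvgrPdist_le => e e0; near=> m.
apply: le_trans (grid_dist m x) _; apply: ltW.
by near: m; exact: (near_infty_natSinv_lt (PosNum e0)).
Unshelve. all: by end_near. Qed.

Lemma measurable_grid_idx m k : measurable (grid_idx m @^-1` [set k] : set mR).
Proof.
have -> : grid_idx m @^-1` [set k] =
    [set` `[k%:~R / m.+1%:R, (k + 1)%:~R / m.+1%:R[%R] :> set R.
  have m0 : 0 < m.+1%:R :> R by rewrite ltr0n.
  apply/seteqP; split=> x /=; rewrite in_itv /= ler_pdivrMr// ltr_pdivlMr//.
  - by move=> <-; rewrite mulrC floor_itv// num_real.
  - by rewrite mulrC => xk; apply: floor_def.
exact: measurable_itv.
Qed.

Definition gridn_idx n m (t : n.-tuple mR) : n.-tuple int := map_tuple (grid_idx m) t.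

Lemma measurable_gridn_idx n m k : measurable (@gridn_idx n m @^-1` [set k]).
Proof.
have -> : @gridn_idx n m @^-1` [set k] =
    \bigcap_(i in [set: 'I_n]) ((@tnth n mR)^~ i @^-1` (grid_idx m @^-1` [set tnth k i])).
  apply/seteqP; split=> [t <- i _|t tk] /=; first by rewrite tnth_map.
  by apply: eq_from_tnth => i; rewrite tnth_map; exact: tk.
apply: fin_bigcap_measurable => // i _.
by rewrite -[X in measurable X]setTI; apply: measurable_tnth => //; exact: measurable_grid_idx.
Qed.

Lemma row_grid_cvg n (t : n.-tuple mR) :
  \row_j grid_pt m (tnth (gridn_idx m t) j) @[m --> \oo] --> (\row_j tnth t j : 'rV[R]_n).
Proof.
apply/cvg_ballP => e e0; near=> m; split=> // i j; rewrite !mxE tnth_map.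
rewrite /ball /=; apply: le_lt_trans (grid_dist m _) _.
by near: m; exact: (near_infty_natSinv_lt (PosNum e0)).
Unshelve. all: by end_near. Qed.

(** Rounding x and xi to grids exhibits H as an iterated limit of functions
    with countably many values: first the grid for xi is refined, by continuity
    in xi, and then the grid for x. *)
Lemma measurable_separately_continuous n (H : R -> 'rV[R]_n -> R) :
  (forall v, continuous (H^~ v)) -> (forall x, continuous (H x)) ->
  measurable_fun setT (fun t : n.+1.-tuple mR =>
    H (tnth t ord0) (\row_j tnth t (lift ord0 j))).
Proof.
move=> cH1 cH2.
pose tl (t : n.+1.-tuple mR) : n.-tuple mR := [tuple tnth t (lift ord0 j) | j < n].
have rtl t : \row_j tnth t (lift ord0 j) = \row_j tnth (tl t) j.
  by apply/rowP => j; rewrite !mxE tnth_mktuple.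
have mtl : measurable_fun setT tl.
  apply/measurable_fun_tnthP => j.
  apply: eq_measurable_fun (measurable_tnth (lift ord0 j)) => t _ /=.
  by rewrite tnth_mktuple.
have mhd := @measurable_tnth _ mR n.+1 ord0.
apply: (measurable_fun_cvg (h := fun m t => H (grid_pt m (grid_idx m (tnth t ord0)))
   (\row_j tnth t (lift ord0 j)))) => [m|t _]; last first.
  have c := @continuous_cvg _ _ _ _ _ _ (H^~ (\row_j tnth t (lift ord0 j))) _ (cH1 _ _) (@grid_cvg (tnth t ord0)).
  exact: c.
apply: (measurable_countable_limit
  (q := fun p t => (grid_idx m (tnth t ord0), gridn_idx p (tl t)))
  (f := fun p k => H (grid_pt m k.1) (\row_j grid_pt p (tnth k.2 j)))) => [p [k1 k2]|t].
  rewrite [X in measurable X](_ : _ =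
    ((fun t => tnth t ord0) @^-1` (grid_idx m @^-1` [set k1])) `&`
    (tl @^-1` (@gridn_idx n p @^-1` [set k2]))).
    apply: measurableI; rewrite -[X in measurable X]setTI.
      by apply: mhd => //; exact: measurable_grid_idx.
    by apply: mtl => //; exact: measurable_gridn_idx.
  by apply/seteqP; split=> t /= [-> ->].
rewrite rtl /=.
have c := @continuous_cvg _ _ _ _ _ _ (H (grid_pt m (grid_idx m (tnth t ord0)))) _ (cH2 _ _) (@row_grid_cvg n (tl t)).
exact: c.
Qed.

End grid.

(** * Goursat's theorem for differential forms in the plane *)

Section goursat.
Variable R : realType.
Implicit Types (P Q p q : R -> R -> R).

Lemma increment_le (f df : R -> R) (a l e : R) : 0 <= l ->
  (forall x, a <= x <= a + l -> is_derive x 1 f (df x)) ->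
  (forall x, a <= x <= a + l -> `|df x| <= e) -> `|f (a + l) - f a| <= e * l.
Proof.
move=> l0 dfx dfe.
have al : a <= a + l by rewrite lerDl.
have [|| c] := @MVT_segment R f df a (a + l) al.
- by move=> x /[!in_itv]/= /andP[ax xl]; apply: dfx; rewrite !ltW.
- apply: derivable_within_continuous => x /[!in_itv]/= axl.
  by have [] := dfx x axl.
rewrite in_itv /= => acl ->.
by rewrite addrAC subrr add0r normrM (ger0_norm l0) ler_wpM2r// dfe.
Qed.

(** The integral of p ds + q dt around the rectangle with corner (a, b) and
    sides l, m, where P is a primitive of p in s and Q one of q in t.  In terms
    of primitives its additivity under subdivision is an algebraic
    identity. *)
Definition circulation P Q (a b l m : R) :=
  (P (a + l) b - P a b) - (P (a + l) (b + m) - P a (b + m))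
  + ((Q (a + l) (b + m) - Q (a + l) b) - (Q a (b + m) - Q a b)).

Lemma circulation_split P Q a b l m :
  circulation P Q a b l m =
  circulation P Q a b (l / 2) (m / 2)
  + circulation P Q (a + l / 2) b (l / 2) (m / 2)
  + circulation P Q a (b + m / 2) (l / 2) (m / 2)
  + circulation P Q (a + l / 2) (b + m / 2) (l / 2) (m / 2).
Proof.
rewrite /circulation -[a + l / 2 + _]addrA -[b + m / 2 + _]addrA -!splitr; ring.
Qed.

(** First-order expansions of p and q at each point, in which the coefficient v
    of t in p equals that of s in q: the form p ds + q dt is closed. *)
Definition closed_form p q := forall s0 t0, exists u v w, forall e, 0 < e ->
  exists2 d, 0 < d & forall s t, `|s - s0| <= d -> `|t - t0| <= d ->
    `|p s t - p s0 t0 - u * (s - s0) - v * (t - t0)| <= e * (`|s - s0| + `|t - t0|)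
    /\ `|q s t - q s0 t0 - v * (s - s0) - w * (t - t0)| <= e * (`|s - s0| + `|t - t0|).

Let half (x : R) k : x / 2 ^+ k / 2 = x / 2 ^+ k.+1.
Proof. by rewrite exprSr invfM mulrA. Qed.

Lemma nested_intervals (c : nat -> R) r : 0 <= r ->
  (forall k, c k.+1 = c k \/ c k.+1 = c k + r / 2 ^+ k.+1) ->
  exists x, forall k, c k <= x <= c k + r / 2 ^+ k.
Proof.
move=> r0 cS.
have rk k : 0 <= r / 2 ^+ k by rewrite divr_ge0// exprn_ge0.
have step k : c k <= c k.+1 /\ c k.+1 + r / 2 ^+ k.+1 <= c k + r / 2 ^+ k.
  by have := rk k.+1; case: (cS k) => ->; rewrite -(half r k) => ?; split; lra.
have up k j : c k <= c (k + j)%N.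
  by elim: j => [|j IHj]; rewrite ?addn0// addnS (le_trans IHj)//; have [] := step (k + j)%N.
have dn k j : c (k + j)%N + r / 2 ^+ (k + j) <= c k + r / 2 ^+ k.
  by elim: j => [|j IHj]; rewrite ?addn0// addnS; apply: le_trans IHj; have [] := step (k + j)%N.
have ub k j : c j <= c k + r / 2 ^+ k.
  have [kj|jk] := leqP k j.
    by rewrite -(subnKC kj); apply: le_trans (dn k (j - k)%N); rewrite lerDl.
  rewrite (le_trans (up j (k - j)%N))// subnKC ?(ltnW jk)// lerDl//.
exists (sup (range c)) => k; apply/andP; split.
  by apply: ub_le_sup; [exists (c 0%N + r / 2 ^+ 0) => _ [j _ <-]|exists k].
by apply: ge_sup; [exists (c 0%N), 0%N|move=> _ [j _ <-]].
Qed.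

Variables (K : R) (P Q p q : R -> R -> R).
Hypothesis dP : forall s t, - K < s -> is_derive s 1 (P^~ t) (p s t).
Hypothesis dQ : forall s t, - K < t -> is_derive t 1 (Q s) (q s t).
Hypothesis pq : closed_form p q.

(** The primitives of the affine parts of p and q at (s0, t0) have circulation
    zero, by closedness, so they may be subtracted from P and Q; the remaining
    four increments are small by the mean value theorem. *)
Lemma circulation_small s0 t0 e : 0 < e -> exists2 d, 0 < d &
  forall a b l m, 0 <= l <= d -> 0 <= m <= d -> - K < a -> - K < b ->
    a <= s0 <= a + l -> b <= t0 <= b + m ->
  `|circulation P Q a b l m| <= 4 * e * (l + m) ^+ 2.
Proof.
move=> e0; have [u [v [w /(_ e e0)[d d0 pqd]]]] := pq s0 t0.
exists d => // a b l m /andP[l0 ld] /andP[m0 md] Ka Kb /andP[as0 s0l] /andP[bt0 t0m].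
pose P' s t := P s t - (p s0 t0 * s + u / 2 * (s - s0) ^+ 2 + v * (t - t0) * s).
pose Q' s t := Q s t - (q s0 t0 * t + v * (s - s0) * t + w / 2 * (t - t0) ^+ 2).
have -> : circulation P Q a b l m = circulation P' Q' a b l m.
  by rewrite /circulation /P' /Q'; field.
have dP' s t : - K < s -> is_derive s 1 (P'^~ t) (p s t - p s0 t0 - u * (s - s0) - v * (t - t0)).
  move=> Ks; have := dP t Ks => dPs.
  rewrite /P'; apply: is_derive_eq; rewrite /GRing.scale /= !(mulr0, mul0r, addr0, mulr1, subr0, add0r) /=.
  by field.
have dQ' s t : - K < t -> is_derive t 1 (Q' s) (q s t - q s0 t0 - v * (s - s0) - w * (t - t0)).
  move=> Kt; have := dQ s Kt => dQs.
  rewrite /Q'; apply: is_derive_eq; rewrite /GRing.scale /= !(mulr0, mul0r, addr0, mulr1, subr0, add0r) /=.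
  by field.
have bnd s t : a <= s <= a + l -> b <= t <= b + m ->
    [/\ `|s - s0| <= l, `|t - t0| <= m & e * (`|s - s0| + `|t - t0|) <= e * (l + m)].
  move=> /andP[as1 sl] /andP[bt tm].
  have h1 : `|s - s0| <= l by rewrite ler_norml; apply/andP; split; lra.
  have h2 : `|t - t0| <= m by rewrite ler_norml; apply/andP; split; lra.
  by split => //; rewrite ler_pM2l// lerD.
have incP t : b <= t <= b + m -> `|P' (a + l) t - P' a t| <= e * (l + m) ^+ 2.
  move=> tb; apply: (@le_trans _ _ (e * (l + m) * l)).
    apply: (@increment_le (P'^~ t)) => // [x /andP[ax _]|x xal].
      by apply: dP'; exact: lt_le_trans ax.
    have [xs ts le] := bnd _ _ xal tb; apply: le_trans le.
    by have [] := pqd x t (le_trans xs ld) (le_trans ts md).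
  rewrite expr2 mulrA ler_wpM2l ?mulr_ge0 ?addr_ge0 ?(ltW e0)//; lra.
have incQ s : a <= s <= a + l -> `|Q' s (b + m) - Q' s b| <= e * (l + m) ^+ 2.
  move=> sa; apply: (@le_trans _ _ (e * (l + m) * m)).
    apply: (@increment_le (Q' s)) => // [x /andP[ax _]|x xbm].
      by apply: dQ'; exact: lt_le_trans ax.
    have [xs ts le] := bnd _ _ sa xbm; apply: le_trans le.
    by have [] := pqd s x (le_trans xs ld) (le_trans ts md).
  rewrite expr2 mulrA ler_wpM2l ?mulr_ge0 ?addr_ge0 ?(ltW e0)//; lra.
have h1 : `|P' (a + l) b - P' a b| <= e * (l + m) ^+ 2 by apply: incP; lra.
have h2 : `|P' (a + l) (b + m) - P' a (b + m)| <= e * (l + m) ^+ 2 by apply: incP; lra.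
have h3 : `|Q' (a + l) (b + m) - Q' (a + l) b| <= e * (l + m) ^+ 2 by apply: incQ; lra.
have h4 : `|Q' a (b + m) - Q' a b| <= e * (l + m) ^+ 2 by apply: incQ; lra.
rewrite /circulation; move: h1 h2 h3 h4; rewrite !ler_norml.
move=> /andP[? ?] /andP[? ?] /andP[? ?] /andP[? ?]; apply/andP; split; lra.
Qed.

Section bisection.
Variables (a b l m : R).
Hypotheses (Ka : - K < a) (Kb : - K < b) (l0 : 0 <= l) (m0 : 0 <= m).

(** Otherwise the circulations around the four quarters would not add up to
    that around the whole. *)
Lemma circulation_quarter a1 b1 l1 m1 : exists xy : R * R,
  [/\ xy.1 = a1 \/ xy.1 = a1 + l1 / 2, xy.2 = b1 \/ xy.2 = b1 + m1 / 2 &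
  `|circulation P Q a1 b1 l1 m1| <= 4 * `|circulation P Q xy.1 xy.2 (l1 / 2) (m1 / 2)|].
Proof.
pose X := `|circulation P Q a1 b1 l1 m1|; rewrite -/X.
have [h1|h1] := leP X (4 * `|circulation P Q a1 b1 (l1 / 2) (m1 / 2)|).
  by exists (a1, b1); split=> //=; left.
have [h2|h2] := leP X (4 * `|circulation P Q (a1 + l1 / 2) b1 (l1 / 2) (m1 / 2)|).
  by exists (a1 + l1 / 2, b1); split=> //=; [right|left].
have [h3|h3] := leP X (4 * `|circulation P Q a1 (b1 + m1 / 2) (l1 / 2) (m1 / 2)|).
  by exists (a1, b1 + m1 / 2); split=> //=; [left|right].
have [h4|h4] := leP X (4 * `|circulation P Q (a1 + l1 / 2) (b1 + m1 / 2) (l1 / 2) (m1 / 2)|).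
  by exists (a1 + l1 / 2, b1 + m1 / 2); split=> //=; right.
exfalso; have := lexx X; rewrite {2}/X circulation_split.
move: h1 h2 h3 h4; set c1 := circulation _ _ a1 b1 _ _; set c2 := circulation _ _ _ b1 _ _.
set c3 := circulation _ _ a1 _ _ _; set c4 := circulation _ _ _ _ _ _.
have := ler_normD (c1 + c2 + c3) c4; have := ler_normD (c1 + c2) c3.
have := ler_normD c1 c2; lra.
Qed.

Let corner := fix corner k : R * R :=
  if k is k'.+1 then
    projT1 (cid (circulation_quarter (corner k').1 (corner k').2 (l / 2 ^+ k') (m / 2 ^+ k')))
  else (a, b).

Let cornerP k :
  [/\ (corner k.+1).1 = (corner k).1 \/ (corner k.+1).1 = (corner k).1 + l / 2 ^+ k.+1,
   (corner k.+1).2 = (corner k).2 \/ (corner k.+1).2 = (corner k).2 + m / 2 ^+ k.+1 &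
   `|circulation P Q (corner k).1 (corner k).2 (l / 2 ^+ k) (m / 2 ^+ k)| <=
   4 * `|circulation P Q (corner k.+1).1 (corner k.+1).2 (l / 2 ^+ k.+1) (m / 2 ^+ k.+1)|].
Proof. by rewrite /=; case: cid => xy /= []; rewrite !half. Qed.

Let corner_circ k : `|circulation P Q a b l m| <=
  4 ^+ k * `|circulation P Q (corner k).1 (corner k).2 (l / 2 ^+ k) (m / 2 ^+ k)|.
Proof.
elim: k => [|k IHk]; first by rewrite !expr0 !divr1 mul1r.
apply: le_trans IHk _; rewrite [in leRHS]exprSr -mulrA ler_wpM2l ?exprn_ge0//.
by have [_ _] := cornerP k.
Qed.

Lemma corner_ge k : a <= (corner k).1 /\ b <= (corner k).2.
Proof.
elim: k => [//|k [IH1 IH2]]; have [h1 h2 _] := cornerP k.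
have l' : 0 <= l / 2 ^+ k.+1 by rewrite divr_ge0// exprn_ge0.
have m' : 0 <= m / 2 ^+ k.+1 by rewrite divr_ge0// exprn_ge0.
by split; [case: h1|case: h2] => ->; lra.
Qed.

(** The rectangles obtained by repeatedly choosing a quarter whose circulation
    is at least a fourth shrink to a point.  There [circulation_small] bounds
    the k-th circulation by e * 4^(-k), against a lower bound of
    4^(-k) times the original one. *)
Theorem goursat : circulation P Q a b l m = 0.
Proof.
have [s0 s0P] := nested_intervals (c := fun k => (corner k).1) l0 (fun k => (let: And3 h _ _ := cornerP k in h)).
have [t0 t0P] := nested_intervals (c := fun k => (corner k).2) m0 (fun k => (let: And3 _ h _ := cornerP k in h)).
apply/eqP; rewrite -normr_le0; apply/ler_addgt0Pl => e e0; rewrite addr0.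
(* the factor by which the final estimate exceeds the e of the local one *)
pose D := 4 * (l + m) ^+ 2 + 1.
have D0 : 0 < D by rewrite ltr_wpDl// mulr_ge0// sqr_ge0.
have [d d0 small] := circulation_small s0 t0 (divr_gt0 e0 D0).
have [k kd] : exists k : nat, (l + m) / 2 ^+ k <= d.
  have [k kd] : exists k : nat, (l + m) / d <= k%:R.
    by exists (Num.bound ((l + m) / d)); rewrite ltW// archi_boundP// divr_ge0 ?addr_ge0// ltW.
  exists k; rewrite ler_pdivrMr ?exprn_gt0// mulrC -ler_pdivrMr//.
  by rewrite (le_trans kd)// -natrX ler_nat ltnW// ltn_expl.
have l' : 0 <= l / 2 ^+ k by rewrite divr_ge0// exprn_ge0.
have m' : 0 <= m / 2 ^+ k by rewrite divr_ge0// exprn_ge0.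
have [ca cb] := corner_ge k.
have := small (corner k).1 (corner k).2 (l / 2 ^+ k) (m / 2 ^+ k).
have ld : l / 2 ^+ k <= d by apply: le_trans kd; rewrite mulrDl lerDl.
have md : m / 2 ^+ k <= d by apply: le_trans kd; rewrite mulrDl lerDr.
rewrite l' m' ld md => /(_ isT isT (lt_le_trans Ka ca) (lt_le_trans Kb cb) (s0P k) (t0P k)) le4.
apply: le_trans (corner_circ k) _.
apply: (@le_trans _ _ (4 * (e / D) * (l + m) ^+ 2)).
  apply: le_trans (ler_wpM2l _ le4) _; first exact: exprn_ge0.
  have -> : 4 ^+ k = (2 ^+ k) ^+ 2 :> R by rewrite exprAC expr2 -natrM.
  have k0 : 2 ^+ k != 0 :> R by rewrite expf_neq0.
  move: (e / D) (2 ^+ k) k0 => r x x0.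
  by rewrite le_eqVlt; apply/orP; left; apply/eqP; field.
rewrite mulrAC mulrA ler_pdivrMr// mulrC ler_pM2l//.
by rewrite /D lerDl.
Qed.

End bisection.
End goursat.

(** * Shifting the line of integration in a strip *)

Section strip.
Variable R : realType.
Local Notation leb := (@lebesgue_measure R).
Local Notation mR := (measurableTypeR R).

Lemma cvg_Rintegral_symitv (f : mR -> R) C : measurable_fun setT f ->
  (forall x, `|f x| <= C * weight1 x) ->
  Rintegral leb [set` `]- n.+1%:R, n.+1%:R]] f @[n --> \oo] --> Rintegral leb setT f.
Proof.
move=> mf fC.
pose g n : mR -> R := f \_ [set` `]- n.+1%:R, n.+1%:R]].
have iC := integrable_dominated (integrable_weight1 R)  mf fC.
have -> : (fun n : nat => Rintegral leb [set` `]- n.+1%:R, n.+1%:R]] f) =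
    (fun n => fine (\int[leb]_(x in setT) (EFin \o g n) x)%E).
  by apply/funext => n; rewrite Rintegral_mkcond.
apply: fine_cvg; rewrite fineK; last exact: integrable_fin_num iC.
apply: (@dominated_cvg _ _ _ leb setT measurableT (fun n => EFin \o g n) (EFin \o f)
  (fun x => (C * weight1 x)%:E)) => //.
- move=> n; apply/measurable_EFinP; apply/(measurable_restrictT _ _).1 => //.
  exact: measurable_funTS.
- move=> x _; apply: cvg_EFin; first by near=> n.
  apply: cvg_near_cst; near=> n; rewrite /g /= patchE ifT// inE/= in_itv/=.
  have : `|x| < n.+1%:R.
    near: n; exists (Num.bound `|x|) => // k /= xk.
    by rewrite (lt_le_trans (archi_boundP (normr_ge0 x)))// ler_nat ltnW.
  by rewrite ltr_norml => /andP[-> /ltW].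
- exact: (integrableZl measurableT C (integrable_weight1 R)).
- move=> n x _; rewrite lee_fin /= /g patchE; case: ifP => _; first exact: fC.
  by rewrite normr0; exact: le_trans (fC x).
Unshelve. all: by end_near. Qed.

Lemma is_derive_primitive (f : R -> R) (K x : R) : continuous f -> - K < x ->
  is_derive x 1 (fun y => Rintegral leb `[- K, y] f) (f x).
Proof.
move=> cf Kx.
pose F y := Rintegral leb `[- K, y] f.
suff [d D] : derivable F x 1 /\ derive1 F x = f x by apply: (DeriveDef d); rewrite -D derive1E.
apply: (@continuous_FTC1_closed R f (- K) x (x + 1)) => //; last exact: cf.
- by rewrite ltrDl.
- apply: continuous_compact_integrable; first exact: segment_compact.
  exact: continuous_subspaceT.
Qed.

Section closed_form_continuous.
Variables p q : R -> R -> R.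
Hypothesis pq : closed_form p q.

Let lip_continuous (f : R -> R) x A d : 0 < d ->
  (forall y, `|y - x| <= d -> `|f y - f x| <= A * `|y - x|) -> {for x, continuous f}.
Proof.
move=> d0 fA; apply/cvgrPdist_le => e e0.
have A0 : 0 < `|A| + 1 by rewrite ltr_wpDl.
apply/nbhs_ballP; exists (Num.min d (e / (`|A| + 1))).
  by rewrite /= lt_min d0 divr_gt0.
move=> y xy; have : `|y - x| < Num.min d (e / (`|A| + 1)) by rewrite distrC; exact: xy.
rewrite lt_min => /andP[/ltW yd]; rewrite ltr_pdivlMr// => ye.
rewrite distrC (le_trans (fA y yd))// (le_trans _ (ltW ye))// mulrC ler_wpM2l//.
by rewrite (le_trans (ler_norm _))// lerDl.
Qed.

Lemma closed_form_continuous1 t : continuous (p^~ t).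
Proof.
move=> s; have [u [v [w /(_ 1 ltr01)[d d0 pqd]]]] := pq s t.
apply: (lip_continuous (A := `|u| + 1) d0) => y yd.
have := (pqd y t yd _).1; rewrite subrr normr0 mulr0 subr0 addr0 mul1r => /(_ (ltW d0)) h.
rewrite -(subrK (u * (y - s)) (p y t - p s t)) (le_trans (ler_normD _ _))//.
by rewrite normrM mulrDl mul1r addrC lerD2l.
Qed.

Lemma closed_form_continuous2 s : continuous (q s).
Proof.
move=> t; have [u [v [w /(_ 1 ltr01)[d d0 pqd]]]] := pq s t.
apply: (lip_continuous (A := `|w| + 1) d0) => y yd.
have := (pqd s y _ yd).2; rewrite subrr normr0 mulr0 subr0 add0r mul1r => /(_ (ltW d0)) h.
rewrite -(subrK (w * (y - t)) (q s y - q s t)) (le_trans (ler_normD _ _))//.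
by rewrite normrM mulrDl mul1r addrC lerD2l.
Qed.

End closed_form_continuous.

(** The circulation around [-N, N] x [t1, t2] vanishes, and the integrals over
    the two vertical sides are O(1/N) because q is dominated by 1/(1+s^2). *)
Theorem strip_shift p q C t1 t2 : closed_form p q -> t1 <= t2 ->
  (forall s t, t1 <= t <= t2 -> `|p s t| <= C * weight1 s) ->
  (forall s t, t1 <= t <= t2 -> `|q s t| <= C * weight1 s) ->
  Rintegral leb setT (p^~ t1) = Rintegral leb setT (p^~ t2).
Proof.
move=> pq t12 pC qC.
have C0 : 0 <= C.
  have := pC 0 t1; rewrite lexx t12 => /(_ isT); rewrite -ler_pdivrMr ?weight1_gt0//.
  by apply: le_trans; rewrite divr_ge0// ltW// weight1_gt0.
have cp t := @closed_form_continuous1 _ _ pq t.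
have cvgI t : t1 <= t <= t2 ->
    Rintegral leb [set` `]- n.+1%:R, n.+1%:R]] (p^~ t) @[n --> \oo] --> Rintegral leb setT (p^~ t).
  move=> t12'; apply: (@cvg_Rintegral_symitv _ C) => [|s]; last exact: pC.
  exact: continuous_measurable_fun.
have h1 : t1 <= t1 <= t2 by rewrite lexx.
have h2 : t1 <= t2 <= t2 by rewrite t12 lexx.
have {}cvgI := cvgB (cvgI t1 h1) (cvgI t2 h2).
have {}cvgI := cvgI eventually_filter.
apply/eqP; rewrite -subr_eq0 -normr_le0; apply/ler_addgt0Pl => e e0; rewrite addr0.
have t21 : 0 <= t2 - t1 by rewrite subr_ge0.
have D0 : 0 < 2 * (C * (t2 - t1)) + 1 by rewrite ltr_wpDl// !mulr_ge0.
rewrite -(cvg_lim _ (cvg_norm cvgI))//.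
apply: limr_le; first by apply/cvg_ex; eexists; exact: cvg_norm cvgI.
near=> n.
pose N : R := n.+1%:R; have N0 : 0 < N by rewrite ltr0n.
(* the primitives start at - K, which lies beyond the whole rectangle *)
pose K := N + 1 + `|t1|.
pose P s t := Rintegral leb `[- K, s] (p^~ t).
pose Q s t := Rintegral leb `[- K, t] (q s).
have KN : - K < - N by rewrite /K; have := normr_ge0 t1; lra.
have Kt : - K < t1 by rewrite /K; have := ler_norm (- t1); rewrite normrN; lra.
have dP s t : - K < s -> is_derive s 1 (P^~ t) (p s t).
  by move=> Ks; exact: is_derive_primitive.
have dQ s t : - K < t -> is_derive t 1 (Q s) (q s t).
  by move=> Kt'; apply: is_derive_primitive => //; exact: (closed_form_continuous2 pq).
have N2 : 0 <= N + N by rewrite ltW// addr_gt0.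
have := goursat dP dQ pq KN Kt N2 t21.
have -> : circulation P Q (- N) t1 (N + N) (t2 - t1) = P N t1 - P (- N) t1
    - (P N t2 - P (- N) t2) + (Q N t2 - Q N t1 - (Q (- N) t2 - Q (- N) t1)).
  by rewrite /circulation (subrKC t1) (_ : - N + (N + N) = N)//; ring.
have IP t : Rintegral leb `](- N), N] (p^~ t) = P N t - P (- N) t.
  rewrite /P Rintegral_itvB//= ?bnd_simp; [|lra|lra].
  apply: continuous_compact_integrable; first exact: segment_compact.
  exact: continuous_subspaceT.
clearbody P Q.
have IQ s : s = N \/ s = - N -> `|Q s t2 - Q s t1| <= C * n.+1%:R^-1 * (t2 - t1).
  move=> sN; have t2E : t2 = t1 + (t2 - t1) by rewrite subrKC.
  rewrite {1}t2E.
  apply: (@increment_le _ (Q s) (q s)) => // [x /andP[t1x _]|x].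
    by apply: dQ; exact: lt_le_trans t1x.
  rewrite subrKC => xt; apply: le_trans (qC _ _ xt) _; rewrite ler_wpM2l//.
  have -> : weight1 s = weight1 N.
    by case: sN => ->//; rewrite /weight1 /oneDsqr sqrrN.
  rewrite /weight1 lef_pV2 ?posrE ?ltr_wpDr ?sqr_ge0//.
  rewrite /oneDsqr -/N expr2; have : 1 <= N by rewrite ler1n.
  nra.
rewrite -!IP => circ0.
have E : Rintegral leb `](- N), N] (p^~ t1) - Rintegral leb `](- N), N] (p^~ t2) =
    (Q (- N) t2 - Q (- N) t1) - (Q N t2 - Q N t1) by lra.
rewrite [X in `|X| <= _](_ : _ = (Q (- N) t2 - Q (- N) t1) - (Q N t2 - Q N t1)); last exact: E.
apply: le_trans (ler_normB _ _) _.
apply: (@le_trans _ _ (C * n.+1%:R^-1 * (t2 - t1) + C * n.+1%:R^-1 * (t2 - t1))).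
  by apply: lerD; apply: IQ; [right|left].
have : n.+1%:R^-1 < e / (2 * (C * (t2 - t1)) + 1).
  by near: n; exact: (near_infty_natSinv_lt (PosNum (divr_gt0 e0 D0))).
have n0 : 0 < n.+1%:R^-1 :> R by rewrite invr_gt0 ltr0n.
rewrite ltr_pdivlMr//; move: n0; move: (n.+1%:R^-1) => v v0 h.
rewrite (_ : _ + _ = v * (2 * (C * (t2 - t1)) + 1) - v); last by ring.
lra.
Unshelve. all: by end_near. Qed.

End strip.

(** * Complex functions of one variable *)

Section real_taylor.
Variable R : realType.
Implicit Types f df ddf : R -> R.

Lemma increment0_le f df (h M : R) : (forall x : R, is_derive x 1 f (df x)) ->
  (forall x, `|x| <= `|h| -> `|df x| <= M) -> `|f h - f 0| <= M * `|h|.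
Proof.
move=> fE dfM; have [h0|h0] := leP 0 h.
  rewrite (ger0_norm h0) -{1}[h]add0r; apply: (increment_le h0) => // x.
  rewrite add0r => /andP[x0 xh]; apply: dfM.
  by rewrite !ger0_norm// (le_trans x0).
have nh : 0 <= - h by lra.
have /= := @increment_le _ f df h (- h) M nh.
rewrite subrr distrC (ltr0_norm h0); apply => // x /andP[hx x0]; apply: dfM.
by rewrite (ltr0_norm h0) ler0_norm//; lra.
Qed.

Lemma taylor2_le f df ddf (h M : R) : (forall x : R, is_derive x 1 f (df x)) ->
  (forall x : R, is_derive x 1 df (ddf x)) ->
  (forall x, `|x| <= `|h| -> `|ddf x| <= M) ->
  `|f h - f 0 - h * df 0| <= M * h ^+ 2.
Proof.
move=> fE dfE ddfM.
have M0 : 0 <= M by apply: le_trans (ddfM 0 _) => //; rewrite normr0.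
pose F x := f x - x * df 0.
have FE (x : R) : is_derive x 1 F (df x - df 0).
  have := fE x => fEx; apply: is_derive_eq.
  by rewrite /GRing.scale /= mulr1 mulr0 add0r.
have /= := @increment0_le F (fun x => df x - df 0) h (M * `|h|) FE.
rewrite /F mul0r subr0 -mulrA -expr2 real_normK ?num_real// addrAC; apply => x xh.
apply: le_trans (@increment0_le df ddf x M dfE _) _ => [y yx|].
  by apply: ddfM; exact: le_trans yx xh.
exact: ler_wpM2l.
Qed.

End real_taylor.

Section complex_norm.
Variable R : realType.
Local Notation C := R[i].
Implicit Types z w : C.

Lemma normc_ge0 z : 0 <= normc z.
Proof. by case: z => a b; exact: sqrtr_ge0. Qed.

Lemma normcD_le z w : normc (z + w) <= normc z + normc w.
Proof. exact: (@ler_normD _ (Rcomplex R) z w). Qed.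

Lemma normr_Re_le z : `|complex.Re z| <= normc z.
Proof.
by case: z => a b /=; rewrite -sqrtr_sqr ler_sqrt ?lerDl ?sqr_ge0// addr_ge0 ?sqr_ge0.
Qed.

Lemma normr_Im_le z : `|complex.Im z| <= normc z.
Proof.
by case: z => a b /=; rewrite -sqrtr_sqr ler_sqrt ?lerDr ?sqr_ge0// addr_ge0 ?sqr_ge0.
Qed.

Lemma normc_le_ReIm z : normc z <= `|complex.Re z| + `|complex.Im z|.
Proof.
case: z => a b /=; rewrite -[leRHS]ger0_norm ?addr_ge0// -sqrtr_sqr.
rewrite ler_sqrt ?sqr_ge0// sqrrD !real_normK ?num_real// lerD2r lerDl.
by rewrite mulrn_wge0// mulr_ge0.
Qed.

Lemma normc_complexE z : `|z| = (normc z)%:C.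
Proof. by case: z => a b; rewrite normc_def. Qed.

Lemma normcN1 : normc (-1 : C) = 1.
Proof. exact: (etrans (@normcN R 1) (@normc1 R)). Qed.

Lemma normc_real (a : R) : normc a%:C = `|a|.
Proof. by rewrite /= expr0n /= addr0 sqrtr_sqr. Qed.

Lemma normc_expi (a : R) : normc (expi a) = 1.
Proof. by rewrite /= cos2Dsin2 sqrtr1. Qed.

Lemma expiD (a b : R) : expi (a + b) = expi a * expi b.
Proof. by rewrite /expi cosD sinD /GRing.mul /= [sin a * _ + _]addrC. Qed.

End complex_norm.

Section complex_differentiability.
Variable R : realType.
Local Notation C := R[i].
Implicit Types (h : C -> C) (z w : C).

(** Complex differentiability, with estimates on the real-valued modulus, to be
    compared with those of [closed_form]. *)
Definition cdiff h z := exists c : C, forall e : R, 0 < e ->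
  exists2 d : R, 0 < d & forall w, normc w <= d ->
    normc (h (z + w) - h z - c * w) <= e * normc w.

Lemma cdiffM h1 h2 z : cdiff h1 z -> cdiff h2 z -> cdiff (fun w => h1 w * h2 w) z.
Proof.
move=> [c1 h1c] [c2 h2c]; exists (c1 * h2 z + h1 z * c2) => e e0.
pose a := normc (h1 z); pose b := normc (h2 z).
pose k1 := normc c1 + 1; pose k2 := normc c2 + 1.
have a0 : 0 <= a by exact: normc_ge0.
have b0 : 0 <= b by exact: normc_ge0.
have k10 : 0 < k1 by rewrite ltr_wpDl// normc_ge0.
have k20 : 0 < k2 by rewrite ltr_wpDl// normc_ge0.
pose s := a + b + 1; have s0 : 0 < s by rewrite ltr_wpDl// addr_ge0.
(* Two terms of the product rule are linear in the remainders, with total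
   coefficient below s; each takes its share of e / 2. *)
pose e' := Num.min (e / (2 * s)) 1.
have e'0 : 0 < e' by rewrite lt_min divr_gt0 ?mulr_gt0//=.
have e'1 : e' <= 1 by rewrite ge_min lexx orbT.
have e's : e' * (2 * s) <= e.
  by rewrite -ler_pdivlMr ?mulr_gt0// ge_min lexx.
have [d1 d10 hd1] := h1c _ e'0; have [d2 d20 hd2] := h2c _ e'0.
(* the product of the two increments is at most k1 * k2 * |w|^2 *)
pose d3 := e / (2 * (k1 * k2)).
have d30 : 0 < d3 by rewrite divr_gt0// !mulr_gt0.
exists (Num.min d1 (Num.min d2 d3)); first by rewrite !lt_min d10 d20.
move=> w; rewrite !le_min => /and3P[/hd1 {}hd1 /hd2 {}hd2 wd3].
set r1 := _ - c1 * w in hd1; set r2 := _ - c2 * w in hd2.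
pose D1 := c1 * w + r1; pose D2 := c2 * w + r2.
have -> : h1 (z + w) * h2 (z + w) - h1 z * h2 z - (c1 * h2 z + h1 z * c2) * w =
    h1 z * r2 + h2 z * r1 + D1 * D2 by rewrite /D1 /D2 /r1 /r2; ring.
have w0 := normc_ge0 w.
have nD1 : normc D1 <= k1 * normc w.
  rewrite (le_trans (normcD_le _ _))// normcM mulrDl mul1r lerD2l (le_trans hd1)//.
  by rewrite ler_piMl.
have nD2 : normc D2 <= k2 * normc w.
  rewrite (le_trans (normcD_le _ _))// normcM mulrDl mul1r lerD2l (le_trans hd2)//.
  by rewrite ler_piMl.
have nDD : normc (D1 * D2) <= e / 2 * normc w.
  rewrite normcM (le_trans (ler_pM (normc_ge0 _) (normc_ge0 _) nD1 nD2))//.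
  rewrite mulrACA mulrA ler_wpM2r// mulrC -ler_pdivlMr ?mulr_gt0//.
  by rewrite -mulrA -invfM.
apply: le_trans (normcD_le _ _) _.
rewrite (_ : e * normc w = e / 2 * normc w + e / 2 * normc w); last by field.
apply: lerD => //; apply: le_trans (normcD_le _ _) _; rewrite !normcM -/a -/b.
apply: (@le_trans _ _ ((a + b) * (e' * normc w))).
  by rewrite mulrDl lerD// ler_wpM2l.
rewrite mulrA ler_wpM2r// ler_pdivlMr//.
apply: le_trans e's; rewrite mulrAC [leRHS]mulrC ler_wpM2r ?(ltW e'0)//.
by rewrite /s; lra.
Qed.

Lemma cdiff_cst c z : cdiff (fun=> c) z.
Proof.
exists 0 => e e0; exists 1 => // w _; rewrite mul0r subrr subr0 normc0.
by rewrite mulr_ge0 ?normc_ge0// ltW.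
Qed.

(** The entire function exp(i a z). *)
Definition cexpi (a : R) (z : C) : C :=
  (expR (- (a * complex.Im z)))%:C * expi (a * complex.Re z).

Lemma cexpiD a z w : cexpi a (z + w) = cexpi a z * cexpi a w.
Proof.
case: z w => [x y] [x' y']; rewrite /cexpi /= !mulrDr opprD expRD expiD.
by rewrite rmorphM /= mulrACA.
Qed.

Let expR_taylor (y : R) : `|y| <= 1 -> `|expR y - 1 - y| <= expR 1 * y ^+ 2.
Proof.
move=> y1; have /= := @taylor2_le R expR expR expR y (expR 1) _ _ _.
rewrite expR0 mulr1; apply => // x xy; rewrite ger0_norm ?expR_ge0// ler_expR.
by rewrite (le_trans (ler_norm x))// (le_trans xy).
Qed.

Let expR_lip (y : R) : `|y| <= 1 -> `|expR y - 1| <= expR 1 * `|y|.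
Proof.
move=> y1; have /= := @increment0_le R expR expR y (expR 1) _ _.
rewrite expR0; apply => // x xy; rewrite ger0_norm ?expR_ge0// ler_expR.
by rewrite (le_trans (ler_norm x))// (le_trans xy).
Qed.

Let cos_taylor (x : R) : `|cos x - 1| <= x ^+ 2.
Proof.
have /= := @taylor2_le R cos (fun x => - sin x) (fun x => - cos x) x 1 _ _ _.
rewrite cos0 sin0 oppr0 mulr0 subr0 mul1r; apply => y _.
by rewrite normrN ler_norml cos_geN1 cos_le1.
Qed.

Let sin_taylor (x : R) : `|sin x - x| <= x ^+ 2.
Proof.
have /= := @taylor2_le R sin cos (fun x => - sin x) x 1 _ _ _.
rewrite sin0 cos0 subr0 mulr1 mul1r; apply => y _.
by rewrite normrN ler_norml sin_geN1 sin_le1.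
Qed.

Lemma cexpi_taylor a w : `|a| * normc w <= 1 ->
  normc (cexpi a w - 1 - (0 +i* a) * w) <= (4 * expR 1 + 1) * (`|a| * normc w) ^+ 2.
Proof.
case: w => s t; set N := `|a| * normc _ => aw.
pose x := a * s; pose y := - (a * t).
have xN : `|x| <= N by rewrite normrM ler_wpM2l// (normr_Re_le (s +i* t)).
have yN : `|y| <= N by rewrite normrN normrM ler_wpM2l// (normr_Im_le (s +i* t)).
have N0 : 0 <= N by apply: le_trans xN.
have y1 := le_trans yN aw.
have E0 : 0 <= expR 1 :> R by exact: expR_ge0.
have sqN (v : R) : `|v| <= N -> v ^+ 2 <= N ^+ 2.
  by move=> vN; rewrite -[v ^+ 2]real_normK ?num_real// lerXn2r// nnegrE.
have e1 : expR y <= expR 1 by rewrite ler_expR (le_trans (ler_norm y)).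
have -> : cexpi a (s +i* t) - 1 - (0 +i* a) * (s +i* t) =
    (expR y * cos x - 1 - y) +i* (expR y * sin x - x).
  by rewrite /cexpi /expi; congr Complex; rewrite /= -?/x -?/y /y /x; ring.
apply: le_trans (normc_le_ReIm _) _ => /=.
have h1 : `|expR y * cos x - 1 - y| <= expR 1 * N ^+ 2 + expR 1 * N ^+ 2.
  have -> : expR y * cos x - 1 - y = (expR y - 1 - y) + expR y * (cos x - 1) by ring.
  rewrite (le_trans (ler_normD _ _))// lerD//.
    by rewrite (le_trans (expR_taylor y1))// ler_wpM2l// sqN.
  rewrite normrM (ger0_norm (expR_ge0 _)) ler_pM ?expR_ge0//.
  by rewrite (le_trans (cos_taylor x))// sqN.
have h2 : `|expR y * sin x - x| <= expR 1 * N ^+ 2 + (expR 1 * N ^+ 2 + N ^+ 2).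
  have -> : expR y * sin x - x = (expR y - 1) * x + expR y * (sin x - x) by ring.
  rewrite (le_trans (ler_normD _ _))// lerD//.
    rewrite normrM expr2 mulrA ler_pM// (le_trans (expR_lip y1))//.
    by rewrite ler_wpM2l.
  rewrite normrM (ger0_norm (expR_ge0 _)) -[leLHS]addr0 lerD ?sqr_ge0// ler_pM ?expR_ge0//.
  by rewrite (le_trans (sin_taylor x))// sqN.
lra.
Qed.

Lemma cdiff_cexpi a z : cdiff (cexpi a) z.
Proof.
exists (cexpi a z * (0 +i* a)) => e e0.
pose k := normc (cexpi a z) * ((4 * expR 1 + 1) * `|a| ^+ 2) + 1.
have k1 : 0 <= normc (cexpi a z) * ((4 * expR 1 + 1) * `|a| ^+ 2).
  by rewrite mulr_ge0 ?normc_ge0// mulr_ge0 ?sqr_ge0// addr_ge0// mulr_ge0// expR_ge0.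
have k0 : 0 < k by rewrite ltr_wpDl.
have a0 : 0 < `|a| + 1 by rewrite ltr_wpDl.
exists (Num.min (`|a| + 1)^-1 (e / k)).
  by rewrite lt_min invr_gt0 a0 divr_gt0.
move=> w; rewrite le_min => /andP[wa we]; have w0 := normc_ge0 w.
rewrite cexpiD -[X in _ - X - _]mulr1 -mulrA -!mulrBr normcM.
have aw : `|a| * normc w <= 1.
  apply: (@le_trans _ _ ((`|a| + 1) * (`|a| + 1)^-1)).
    by apply: ler_pM => //; rewrite lerDl.
  by rewrite divff// gt_eqF.
apply: le_trans (ler_wpM2l (normc_ge0 _) (cexpi_taylor aw)) _.
rewrite exprMn [normc w ^+ 2]expr2 !mulrA ler_wpM2r// mulrC.
apply: (@le_trans _ _ (normc w * k)); last by rewrite -ler_pdivlMr.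
by rewrite ler_wpM2l// /k !mulrA lerDl.
Qed.

(** The real part of h(z) dz is Re h ds - Im h dt, and its closedness is a
    Cauchy-Riemann equation. *)
Lemma cdiff_closed_form_Re h : (forall z, cdiff h z) ->
  closed_form (fun s t => complex.Re (h (s +i* t))) (fun s t => - complex.Im (h (s +i* t))).
Proof.
move=> hd s0 t0; have [[u v] huv] := hd (s0 +i* t0).
exists u, (- v), (- u) => e e0; have [d d0 hdd] := huv _ e0.
exists (d / 2); first by rewrite divr_gt0.
move=> s t sd td; pose w : C := (s - s0) +i* (t - t0).
have w1 : normc w <= `|s - s0| + `|t - t0| by exact: normc_le_ReIm w.
have wd : normc w <= d by rewrite (le_trans w1)// [d]splitr lerD.
have zw : (s0 +i* t0) + w = s +i* t.
  by rewrite /w; congr Complex; rewrite /= subrKC.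
have := hdd w wd; rewrite zw => hw.
have {}hw := le_trans hw (ler_wpM2l (ltW e0) w1); split.
  apply: le_trans hw; apply: le_trans (normr_Re_le _).
  move: (h (s +i* t)) (h (s0 +i* t0)) => [x y] [x' y'].
  by rewrite le_eqVlt; apply/orP; left; apply/eqP; congr `|_|; rewrite /w /=; ring.
apply: le_trans hw; apply: le_trans (normr_Im_le _).
move: (h (s +i* t)) (h (s0 +i* t0)) => [x y] [x' y'].
rewrite -normrN le_eqVlt; apply/orP; left; apply/eqP; congr `|_|; rewrite /w /=; ring.
Qed.

Lemma cdiff_mulNi h z : cdiff h z -> cdiff (fun w => (0 -i* 1) * h w) z.
Proof. by apply: cdiffM; exact: cdiff_cst. Qed.

Lemma Im_mulNi z : complex.Re ((0 -i* 1) * z) = complex.Im z.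
Proof. by case: z => a b /=; ring. Qed.

Section strip.
Variables (h : C -> C) (A eta : R).
Hypothesis hd : forall z, cdiff h z.
Hypothesis hA : forall s t, `|t| <= `|eta| -> normc (h (s +i* t)) <= A * weight1 s.
Local Notation leb := (@lebesgue_measure R).

(** The lower and the upper line of the strip depend on the sign of eta. *)
Lemma strip_shift_Re :
  Rintegral leb setT (fun s => complex.Re (h (s +i* 0))) =
  Rintegral leb setT (fun s => complex.Re (h (s +i* eta))).
Proof.
have cf := cdiff_closed_form_Re hd.
have bnd t1 t2 : `|t1| <= `|eta| -> `|t2| <= `|eta| ->
    forall s t, t1 <= t <= t2 -> normc (h (s +i* t)) <= A * weight1 s.
  move=> n1 n2 s t /andP[t1t tt2]; apply: hA.
  by move: n1 n2; rewrite !ler_norml => /andP[? ?] /andP[? ?]; apply/andP; split; lra.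
have n0 : `|0 : R| <= `|eta| by rewrite normr0.
have ne : `|eta| <= `|eta| by [].
have [e0|e0] := leP 0 eta.
  apply: (strip_shift (C := A) cf e0) => s t st.
    exact: le_trans (normr_Re_le _) (bnd _ _ n0 ne s t st).
  by rewrite normrN; exact: le_trans (normr_Im_le _) (bnd _ _ n0 ne s t st).
apply/esym; apply: (strip_shift (C := A) cf (ltW e0)) => s t st.
  exact: le_trans (normr_Re_le _) (bnd _ _ ne n0 s t st).
by rewrite normrN; exact: le_trans (normr_Im_le _) (bnd _ _ ne n0 s t st).
Qed.

End strip.

(** The imaginary part of h is the real part of - i h. *)
Lemma strip_shift_Im (h : C -> C) (A eta : R) : (forall z, cdiff h z) ->
  (forall s t, `|t| <= `|eta| -> normc (h (s +i* t)) <= A * weight1 s) ->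
  Rintegral (@lebesgue_measure R) setT (fun s => complex.Im (h (s +i* 0))) =
  Rintegral (@lebesgue_measure R) setT (fun s => complex.Im (h (s +i* eta))).
Proof.
move=> hd hA.
under eq_Rintegral do rewrite -Im_mulNi.
under [RHS]eq_Rintegral do rewrite -Im_mulNi.
apply: (@strip_shift_Re (fun w => (0 -i* 1) * h w) A) => [z|s t te].
  exact: cdiff_mulNi.
by rewrite normcM /= expr0n /= add0r sqrrN expr1n sqrtr1 mul1r hA.
Qed.

Lemma cdiff_entire_slice n (f : 'rV[C]_n -> C) (z : 'rV[C]_n) (j : 'I_n) w0 :
  entire f -> cdiff (fun w => f (z + w *: delta_mx 0 j)) w0.
Proof.
move=> fe; have := fe (z + w0 *: delta_mx 0 j) => df.
have /cvg_ex[l] := @diff_derivable _ _ _ (f : 'rV[C]_n -> C^o) _ (delta_mx 0 j) df.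
move=> /cvgrPdist_le fl; exists l => e e0.
have eC : 0 < (e%:C : C) by rewrite ltcR.
have [d /= d0 hd] := fl _ eC.
have [dr drE] : exists2 dr : R, 0 < dr & d = dr%:C.
  by move: d0; case: d hd => x y hd; rewrite ltcE /= => /andP[/eqP -> x0]; exists x.
move=> dE; exists (dr / 2); first by rewrite divr_gt0.
move=> w wd; have [->|w0'] := eqVneq w 0.
  by rewrite addr0 subrr mulr0 subr0 normc0 mulr0.
have := hd w; rewrite /= sub0r normrN dE !normc_complexE ltcR lecR => /(_ _ w0').
have -> : w *: delta_mx 0 j + (z + w0 *: delta_mx 0 j) = z + (w0 + w) *: delta_mx 0 j.
  by rewrite scalerDl addrCA [w *: _ + _]addrC.
set D := f _ - f _ => h.
have -> : D - l * w = - (w * (l - w^-1 *: D)).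
  by rewrite mulrBr [w^-1 *: D]/(w^-1 * D) mulrA mulfV// mul1r opprB mulrC.
rewrite -mulN1r !normcM normcN1 mul1r mulrC ler_wpM2r ?normc_ge0// h//.
by rewrite (le_lt_trans wd)// ltr_pdivrMr// ltr_pMr// ltr1n.
Qed.

End complex_differentiability.

(** * The transform as a single integral *)

Section complex_continuity.
Variable R : realType.
Local Notation C := R[i].
Local Notation RC := (Rcomplex R).

(** Continuity is stated on the two real parts because measurability will be
    needed for them. *)
Definition ccontinuous (X : topologicalType) (f : X -> C) :=
  continuous (fun x => complex.Re (f x)) /\ continuous (fun x => complex.Im (f x)).

Lemma ccontinuousP (X : topologicalType) (f : X -> C) :
  (forall x (e : R), 0 < e -> \forall y \near x, normc (f x - f y) <= e) ->
  ccontinuous f.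
Proof.
move=> cf; split=> x; apply/cvgrPdist_le => e e0; near=> y.
  apply: (@le_trans _ _ (normc (f x - f y))); last by near: y; exact: cf.
  by apply: le_trans (normr_Re_le _); case: (f x) (f y) => ? ? [].
apply: (@le_trans _ _ (normc (f x - f y))); last by near: y; exact: cf.
by apply: le_trans (normr_Im_le _); case: (f x) (f y) => ? ? [].
Unshelve. all: by end_near. Qed.

Lemma continuous_RC (X : topologicalType) (f : X -> C) :
  continuous (f : X -> RC) -> ccontinuous f.
Proof.
move=> cf; apply: ccontinuousP => x e e0.
by have /cvgrPdist_le/(_ e e0) := cf x.
Qed.

Lemma ccontinuousM (X : topologicalType) (f g : X -> C) :
  ccontinuous f -> ccontinuous g -> ccontinuous (fun x => f x * g x).
Proof.
move=> [rf imf] [rg img]; split => x.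
  rewrite (_ : (fun x => _) = (fun x => complex.Re (f x) * complex.Re (g x)
    - complex.Im (f x) * complex.Im (g x))); last first.
    by apply/funext => y; case: (f y) => ? ?; case: (g y).
  by apply: cvgB; apply: cvgM; [exact: rf|exact: rg|exact: imf|exact: img].
rewrite (_ : (fun x => _) = (fun x => complex.Re (f x) * complex.Im (g x)
  + complex.Im (f x) * complex.Re (g x))); last first.
  by apply/funext => y; case: (f y) => ? ?; case: (g y).
by apply: cvgD; apply: cvgM; [exact: rf|exact: img|exact: imf|exact: rg].
Qed.

Lemma ccontinuous_cst (X : topologicalType) (c : C) : ccontinuous (fun _ : X => c).
Proof. by split=> x; exact: cvg_cst. Qed.

Lemma ccontinuous_comp (X Y : topologicalType) (f : X -> Y) (g : Y -> C) :
  continuous f -> ccontinuous g -> ccontinuous (fun x => g (f x)).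
Proof.
move=> cf [rg img]; split=> x.
  by apply: (@continuous_comp _ _ _ f (fun y => complex.Re (g y))); [exact: cf|exact: rg].
by apply: (@continuous_comp _ _ _ f (fun y => complex.Im (g y))); [exact: cf|exact: img].
Qed.

Lemma ccontinuous_expi : ccontinuous (@expi R).
Proof. by split=> x; [exact: continuous_cos|exact: continuous_sin]. Qed.

Definition complexify n (v : 'rV[R]_n) : 'rV[C]_n := \row_j (v 0 j)%:C.

Lemma entire_modulus n (f : 'rV[C]_n -> C) (z : 'rV[C]_n) (e : R) : entire f -> 0 < e ->
  exists2 d : R, 0 < d & forall z' : 'rV[C]_n,
    (forall i, normc (z 0 i - z' 0 i) < d) -> normc (f z - f z') <= e.
Proof.
move=> fe e0; have /differentiable_continuous := fe z.
have eC : 0 < (e%:C : C) by rewrite ltcR.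
move=> /cvgrPdist_le/(_ _ eC)/nbhs_ballP[d + hd].
case: d hd => a b hd; rewrite /= ltcE /= => /andP[/eqP b0 a0]; subst b.
exists a => // z' zz'; have := hd z'; rewrite normc_complexE lecR; apply.
split; first by rewrite ltcR.
by move=> i j; rewrite (ord1 i) /ball /= normc_complexE ltcR.
Qed.

Lemma entire_ccontinuous n (f : 'rV[C]_n -> C) : entire f ->
  ccontinuous (fun v : 'rV[R]_n => f (complexify v)).
Proof.
move=> fe; apply: ccontinuousP => v e e0.
have [d d0 hd] := entire_modulus (complexify v) fe e0.
apply/nbhs_ballP; exists d => // y [_ vy]; apply: hd => i.
by rewrite !mxE -rmorphB normc_real; exact: vy.
Qed.

Lemma continuous_dotr n (t : 'rV[R]_n) : continuous (fun v : 'rV[R]_n => dotr v t).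
Proof.
apply: (@continuous_big R _ +%R 0 xpredT) => [|i _]; first exact: add_continuous.
by move=> v; have := cvgM (@coord_continuous R 1 n 0 i v) (cvg_cst (t 0 i)); exact.
Qed.

End complex_continuity.

Section complex_integral.
Context {R : realType} {n : nat}.
Local Notation C := R[i].
Local Notation mR := (measurableTypeR R).
Local Notation mu := (lebesgue_tuple R n).
Implicit Types F G : n.-tuple mR -> C.

Definition cmeasurable F := measurable_fun setT (fun T => complex.Re (F T)) /\
  measurable_fun setT (fun T => complex.Im (F T)).

Definition ctame F A := cmeasurable F /\ forall T, normc (F T) <= A * weight T.

Definition total_weight : R := Rintegral mu setT (@weight R n).

Lemma ctame_Re F A : ctame F A -> tame (fun T => complex.Re (F T)).
Proof.
move=> [[mF _] FA]; split=> //; exists A => T.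
exact: le_trans (normr_Re_le _) (FA T).
Qed.

Lemma ctame_Im F A : ctame F A -> tame (fun T => complex.Im (F T)).
Proof.
move=> [[_ mF] FA]; split=> //; exists A => T.
exact: le_trans (normr_Im_le _) (FA T).
Qed.

Lemma normc_cintegral F A : ctame F A -> normc (cintegral mu F) <= 2 * A * total_weight.
Proof.
move=> FA; have [[mr mi] Fb] := FA; apply: le_trans (normc_le_ReIm _) _ => /=.
rewrite -mulrA mulr_natl mulr2n; apply: lerD.
  apply: normr_Rintegral_dominated => //; first exact: integrable_weight.
  by move=> T; exact: le_trans (normr_Re_le _) (Fb T).
apply: normr_Rintegral_dominated => //; first exact: integrable_weight.
by move=> T; exact: le_trans (normr_Im_le _) (Fb T).
Qed.

Lemma cintegral_lin (c : C) F G A B : ctame F A -> ctame G B ->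
  cintegral mu (fun T => c * F T + G T) = c * cintegral mu F + cintegral mu G.
Proof.
move=> tF tG.
have irF := tame_integrable (ctame_Re tF); have iiF := tame_integrable (ctame_Im tF).
have irG := tame_integrable (ctame_Re tG); have iiG := tame_integrable (ctame_Im tG).
have Z (a : R) f : mu.-integrable setT (EFin \o f) ->
    mu.-integrable setT (EFin \o (fun T => a * f T)).
  by move=> fi; exact: (integrableZl measurableT a fi).
have B' f h : mu.-integrable setT (EFin \o f) -> mu.-integrable setT (EFin \o h) ->
    mu.-integrable setT (EFin \o (fun T => f T - h T)).
  by move=> fi hi; exact: (integrableB measurableT fi hi).
have D' f h : mu.-integrable setT (EFin \o f) -> mu.-integrable setT (EFin \o h) ->
    mu.-integrable setT (EFin \o (fun T => f T + h T)).
  by move=> fi hi; exact: (integrableD measurableT fi hi).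
case: c => a b; rewrite /cintegral; congr Complex => /=.
  rewrite (_ : (fun T => _) = (fun T => (a * complex.Re (F T) - b * complex.Im (F T))
    + complex.Re (G T))); last by apply/funext => T; case: (F T); case: (G T).
  rewrite RintegralD//; last by apply: B'; apply: Z.
  by rewrite RintegralB//; [rewrite !RintegralZl|apply: Z|apply: Z].
rewrite (_ : (fun T => _) = (fun T => (a * complex.Im (F T) + b * complex.Re (F T))
    + complex.Im (G T))); last by apply/funext => T; case: (F T); case: (G T).
rewrite RintegralD//; last by apply: D'; apply: Z.
by rewrite RintegralD//; [rewrite !RintegralZl|apply: Z|apply: Z].
Qed.

Lemma ctame_lin (c : C) F G A B : ctame F A -> ctame G B ->
  ctame (fun T => c * F T + G T) (normc c * A + B).
Proof.
move=> [[mrF miF] FA] [[mrG miG] GB]; split; last first.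
  move=> T; rewrite mulrDl (le_trans (normcD_le _ _))// lerD// normcM -mulrA.
  by rewrite ler_wpM2l// normc_ge0.
case: c => a b; split.
  rewrite (_ : (fun T => _) = (fun T => (a * complex.Re (F T) - b * complex.Im (F T))
    + complex.Re (G T))); last by apply/funext => T; case: (F T); case: (G T).
  by apply: measurable_funD => //; apply: measurable_funB; apply: measurable_funM.
rewrite (_ : (fun T => _) = (fun T => (a * complex.Im (F T) + b * complex.Re (F T))
    + complex.Im (G T))); last by apply/funext => T; case: (F T); case: (G T).
by apply: measurable_funD => //; apply: measurable_funD; apply: measurable_funM.
Qed.

End complex_integral.

Section oscillatory_integral.
Context {R : realType} {n : nat}.
Local Notation C := R[i].
Local Notation RC := (Rcomplex R).
Local Notation mR := (measurableTypeR R).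
Local Notation leb := (@lebesgue_measure R).
Implicit Types (Phi : R -> 'rV[C]_n -> C) (g : 'rV[R]_1 -> C) (u t v : 'rV[R]_n).

Definition tuple_tl (T : n.+1.-tuple mR) : n.-tuple mR := [tuple tnth T (lift ord0 j) | j < n].

Lemma tuple_tl_cons x (xi : n.-tuple mR) : tuple_tl [tuple of x :: xi] = xi.
Proof. by apply: eq_from_tnth => j; rewrite tnth_mktuple tnthS. Qed.

Lemma weight_tl (T : n.+1.-tuple mR) : weight T = weight1 (tnth T ord0) * weight (tuple_tl T).
Proof.
rewrite /weight big_ord_recl; congr (_ * _).
by apply: eq_bigr => j _; rewrite tnth_mktuple.
Qed.

(** With x as the head of the tuple, the double integral becomes one integral
    over R^(1+n). *)
Definition total_integrand g u Phi t (T : n.+1.-tuple mR) : C :=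
  DSadj_integrand g u Phi t (tuple_tl T) (tnth T ord0).

Lemma total_integrand_cons g u Phi t x (xi : n.-tuple mR) :
  total_integrand g u Phi t [tuple of x :: xi] = DSadj_integrand g u Phi t xi x.
Proof. by rewrite /total_integrand tuple_tl_cons. Qed.

(** The bound concerns real points only, so that a symbol translated by an
    imaginary vector may be admissible with the same constant. *)
Definition admissible Phi A := [/\ forall z, ccontinuous (Phi^~ z),
  forall x, entire (Phi x) &
  forall x (xi : n.-tuple mR),
    normc (Phi x (\row_j (tnth xi j)%:C)) <= A * (weight1 x * weight xi)].

Definition bounded_window g B := ccontinuous g /\ forall y, normc (g y) <= B.

Lemma ctame_total_integrand g u Phi t A B : admissible Phi A -> bounded_window g B ->
  ctame (total_integrand g u Phi t) (A * B).
Proof.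
move=> [cP eP PA] [cg gB]; split; last first.
  move=> T; rewrite /total_integrand /DSadj_integrand !normcM normc_expi mulr1.
  rewrite mulrAC weight_tl ler_pM ?normc_ge0//.
pose H x (xi : 'rV[R]_n) : C := Phi x (complexify xi) * g (const_mx (dotr u t - x))
  * expi (2 * pi * dotr xi t).
have HE : total_integrand g u Phi t =
    fun T => H (tnth T ord0) (\row_j tnth T (lift ord0 j)).
  apply/funext => T; rewrite /total_integrand /DSadj_integrand /H.
  have -> : \row_j tnth (tuple_tl T) j = \row_j tnth T (lift ord0 j) :> 'rV[R]_n.
    by apply/rowP => j; rewrite !mxE tnth_mktuple.
  congr (Phi _ _ * _ * _).
  by apply/rowP => j; rewrite !mxE tnth_mktuple.
have cH1 xi : ccontinuous (H^~ xi).
  apply: ccontinuousM; last exact: ccontinuous_cst.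
  apply: ccontinuousM; first exact: cP.
  apply: (ccontinuous_comp (f := fun x : R => const_mx (dotr u t - x))) => // x.
  apply/cvg_ballP => e e0; apply/nbhs_ballP; exists e => // y xy; split=> // i j.
  rewrite !mxE; move: xy; rewrite /ball/= => xy.
  by rewrite opprB addrC addrA subrK distrC.
have cH2 x : ccontinuous (H x).
  apply: ccontinuousM.
    apply: ccontinuousM; last exact: ccontinuous_cst.
    exact: entire_ccontinuous.
  apply: (ccontinuous_comp (f := fun xi : 'rV[R]_n => 2 * pi * dotr xi t)).
    by move=> xi; have := cvgM (cvg_cst (2 * pi)) (@continuous_dotr R n t xi); exact.
  exact: ccontinuous_expi.
rewrite HE; split.
  apply: (@measurable_separately_continuous _ _ (fun x xi => complex.Re (H x xi))).
    by move=> xi; exact: (cH1 xi).1.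
  by move=> x; exact: (cH2 x).1.
apply: (@measurable_separately_continuous _ _ (fun x xi => complex.Im (H x xi))).
  by move=> xi; exact: (cH1 xi).2.
by move=> x; exact: (cH2 x).2.
Qed.

Section with_bounds.
Variables (g : 'rV[R]_1 -> C) (u : 'rV[R]_n) (Phi : R -> 'rV[C]_n -> C).
Variables (A B : R).
Hypothesis PA : admissible Phi A.
Hypothesis gB : bounded_window g B.

Let J t := ctame_total_integrand u t PA gB.
Let Jr t T : `|complex.Re (total_integrand g u Phi t T)| <= A * B * weight T.
Proof. exact: le_trans (normr_Re_le _) ((J t).2 T). Qed.
Let Ji t T : `|complex.Im (total_integrand g u Phi t T)| <= A * B * weight T.
Proof. exact: le_trans (normr_Im_le _) ((J t).2 T). Qed.

Lemma DSadj_innerE t (xi : n.-tuple mR) : DSadj_inner g u Phi t xi =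
  Rintegral leb setT (fun x => complex.Re (total_integrand g u Phi t [tuple of x :: xi]))
  +i* Rintegral leb setT (fun x => complex.Im (total_integrand g u Phi t [tuple of x :: xi])).
Proof.
rewrite /DSadj_inner /cintegral; congr Complex; apply: eq_Rintegral => x _;
by rewrite total_integrand_cons.
Qed.

Lemma DSadj_integrable_admissible t : DSadj_integrable g u Phi t.
Proof.
have [[mr mi] _] := J t; split.
  move=> xi; split.
    have := integrable_head_section mr (Jr t) xi.
    by apply: eq_integrable => // x _ /=; rewrite total_integrand_cons.
  have := integrable_head_section mi (Ji t) xi.
  by apply: eq_integrable => // x _ /=; rewrite total_integrand_cons.
split.
  have := tame_integrable (tame_integral_head mr (Jr t)).
  by apply: eq_integrable => // xi _; rewrite DSadj_innerE.
have := tame_integrable (tame_integral_head mi (Ji t)).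
by apply: eq_integrable => // xi _; rewrite DSadj_innerE.
Qed.

(** Fubini's theorem, all sections being dominated by the weight. *)
Lemma DSadjE t : DSadj g u Phi t =
  cintegral (lebesgue_tuple R n.+1) (total_integrand g u Phi t).
Proof.
have [[mr mi] _] := J t; rewrite /DSadj /cintegral; congr Complex.
  rewrite (Rintegral_cons_head mr (Jr t)); apply: eq_Rintegral => xi _.
  by rewrite DSadj_innerE.
rewrite (Rintegral_cons_head mi (Ji t)); apply: eq_Rintegral => xi _.
by rewrite DSadj_innerE.
Qed.

Lemma normc_DSadj_le t : normc (DSadj g u Phi t) <= 2 * (A * B) * @total_weight R n.+1.
Proof. by rewrite DSadjE; exact: normc_cintegral (J t). Qed.

End with_bounds.

End oscillatory_integral.

(** * Decay of symbols and the contour shift *)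

Section decay.
Context {R : realType} {n : nat}.
Local Notation C := R[i].
Local Notation mR := (measurableTypeR R).
Local Notation leb := (@lebesgue_measure R).
Implicit Types (Phi : R -> 'rV[C]_n -> C) (z : 'rV[C]_n) (u t v : 'rV[R]_n).

Definition growth k (x : R) z : R :=
  expR (k%:R * `|x|) * (1 + cnorm z ^+ 2) `^ (k%:R / 2).

Definition decays k Phi A :=
  forall x z, tube k z -> growth k x z * normc (Phi x z) <= A.

Definition regular Phi :=
  (forall z, ccontinuous (Phi^~ z)) /\ (forall x, entire (Phi x)).

Lemma cnorm_ge0 z : 0 <= cnorm z.
Proof. exact: sqrtr_ge0. Qed.

Lemma cnorm_sq z : cnorm z ^+ 2 = \sum_i normc (z 0 i) ^+ 2.
Proof. by rewrite sqr_sqrtr// sumr_ge0// => i _; rewrite sqr_ge0. Qed.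

Lemma normc_sq_le_cnorm z i : normc (z 0 i) ^+ 2 <= cnorm z ^+ 2.
Proof.
by rewrite cnorm_sq (bigD1 i)//= lerDl sumr_ge0// => j _; rewrite sqr_ge0.
Qed.

Lemma normc_le_cnorm z i : normc (z 0 i) <= cnorm z.
Proof.
by rewrite -(@ler_pXn2r _ 2)// ?nnegrE ?normc_ge0 ?cnorm_ge0// normc_sq_le_cnorm.
Qed.

(** The exponential absorbs 1 + x^2, and the power k/2 >= n of 1 + |z|^2
    absorbs the n factors 1 + (Re z_i)^2. *)
Lemma growth_ge k x z : (2 <= k)%N -> (2 * n <= k)%N ->
  oneDsqr x * \prod_i oneDsqr (complex.Re (z 0 i)) <= growth k x z.
Proof.
move=> k2 kn; have c1 : 1 <= 1 + cnorm z ^+ 2 by rewrite lerDl sqr_ge0.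
have c0 : 0 <= 1 + cnorm z ^+ 2 by apply: le_trans c1.
apply: ler_pM.
- by rewrite (le_trans ler01).
- by apply: prodr_ge0 => i _; rewrite (le_trans ler01).
- have kx : 0 <= 2 * `|x| by rewrite mulr_ge0.
  apply: (@le_trans _ _ (expR (2 * `|x|))).
    apply: le_trans (expR_ge1Dxn 1 kx).
    rewrite exprMn real_normK ?num_real// /oneDsqr lerD2l ler_pdivlMr ?ltr0n//.
    by rewrite mulrC ler_wpM2r ?sqr_ge0// -natrX ler_nat.
  by rewrite ler_expR ler_wpM2r// ler_nat.
- apply: (@le_trans _ _ ((1 + cnorm z ^+ 2) `^ n%:R)); last first.
    by apply: ler_powR => //; rewrite ler_pdivlMr// -natrM ler_nat mulnC.
  rewrite powR_mulrn// -[X in _ <= _ ^+ X]card_ord -prodr_const.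
  apply: ler_prod => i _; rewrite (le_trans ler01)//= lerD2l.
  apply: le_trans (normc_sq_le_cnorm z i).
  rewrite -[leLHS]real_normK ?num_real// lerXn2r ?nnegrE ?normc_ge0//.
  exact: normr_Re_le.
Qed.

Lemma decays_le k Phi A x z : (2 <= k)%N -> (2 * n <= k)%N -> decays k Phi A ->
  tube k z ->
  normc (Phi x z) <= A * (weight1 x * \prod_i weight1 (complex.Re (z 0 i))).
Proof.
move=> k2 kn PA kz.
have p0 : 0 < oneDsqr x * \prod_i oneDsqr (complex.Re (z 0 i)).
  apply: mulr_gt0; first exact: lt_le_trans ltr01 (oneDsqr_ge1 x).
  by apply: prodr_gt0 => i _; exact: lt_le_trans ltr01 (oneDsqr_ge1 _).
have -> : weight1 x * \prod_i weight1 (complex.Re (z 0 i)) =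
    (oneDsqr x * \prod_i oneDsqr (complex.Re (z 0 i)))^-1.
  by rewrite invfM -prodfV.
rewrite ler_pdivlMr// mulrC; apply: le_trans (PA x z kz).
by rewrite ler_wpM2r ?normc_ge0// growth_ge.
Qed.

(** The factor 2 pi i <v, z> produced by differentiating exp(2 pi i <z, t>) in
    the direction v. *)
Definition linz v z : C := (0 +i* (2 * pi)) * \sum_i (v 0 i)%:C * z 0 i.

Definition mulz v Phi := fun x z => linz v z * Phi x z.

Lemma mulzC v w Phi : mulz v (mulz w Phi) = mulz w (mulz v Phi).
Proof. by apply/funext => x; apply/funext => z; rewrite /mulz mulrCA. Qed.

Definition mulz_bound v : R := 2 * pi * \sum_i `|v 0 i|.

Lemma mulz_bound_ge0 v : 0 <= mulz_bound v.
Proof. by rewrite !mulr_ge0 ?pi_ge0// sumr_ge0. Qed.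

Lemma normc_sum_le (I : Type) (r : seq I) (P : pred I) (F : I -> C) :
  normc (\sum_(i <- r | P i) F i) <= \sum_(i <- r | P i) normc (F i).
Proof.
elim/big_rec2 : _ => [|i y x _ xy]; first by rewrite normc0.
by rewrite (le_trans (normcD_le _ _))// lerD2l.
Qed.

Lemma normc_linz v z : normc (linz v z) <= mulz_bound v * cnorm z.
Proof.
rewrite normcM /mulz_bound.
have -> : normc (0 +i* (2 * pi) : C) = 2 * pi.
  by rewrite /= expr0n /= add0r sqrtr_sqr ger0_norm// mulr_ge0// pi_ge0.
rewrite -mulrA ler_wpM2l ?mulr_ge0 ?pi_ge0// (le_trans (normc_sum_le _ _ _))//.
rewrite mulr_suml; apply: ler_sum => i _; rewrite normcM normc_real.
by rewrite ler_wpM2l// normc_le_cnorm.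
Qed.

Lemma growth_ge0 k x z : 0 <= growth k x z.
Proof. by rewrite mulr_ge0 ?expR_ge0 ?powR_ge0. Qed.

Lemma growthS k x z : growth k x z * cnorm z <= growth k.+1 x z.
Proof.
rewrite /growth -mulrA; apply: ler_pM; rewrite ?expR_ge0//.
- by rewrite mulr_ge0 ?powR_ge0 ?cnorm_ge0.
- by rewrite ler_expR ler_wpM2r// ler_nat.
have c0 : 0 < 1 + cnorm z ^+ 2 by rewrite ltr_wpDr ?sqr_ge0.
have -> : k.+1%:R / 2 = k%:R / 2 + 2^-1 :> R by rewrite -natr1 mulrDl mul1r.
rewrite powRD; last by rewrite gt_eqF// implybT.
rewrite ler_wpM2l ?powR_ge0// powR12_sqrt ?(ltW c0)//.
by rewrite -[leLHS]ger0_norm ?cnorm_ge0// -sqrtr_sqr ler_sqrt ?(ltW c0)// lerDr.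
Qed.

Lemma tubeS k z : tube k z -> tube k.+1 z.
Proof. by move=> kz i; apply: le_trans (kz i) _; rewrite ler_nat. Qed.

(** The linear factor costs a power 1/2 of 1 + |z|^2, hence one unit of k. *)
Lemma decays_mulz k Phi A v : decays k.+1 Phi A ->
  decays k (mulz v Phi) (mulz_bound v * A).
Proof.
move=> PA x z kz; rewrite /mulz normcM mulrA.
apply: (@le_trans _ _ (mulz_bound v * (growth k.+1 x z * normc (Phi x z)))).
  rewrite mulrA ler_wpM2r ?normc_ge0//.
  apply: (@le_trans _ _ (growth k x z * (mulz_bound v * cnorm z))).
    by rewrite ler_wpM2l ?growth_ge0// normc_linz.
  by rewrite mulrCA ler_wpM2l ?mulz_bound_ge0// growthS.
by rewrite ler_wpM2l ?mulz_bound_ge0// PA//; exact: tubeS.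
Qed.

Lemma decays_leq k l Phi A : (k <= l)%N -> decays l Phi A -> decays k Phi A.
Proof.
move=> kl PA x z kz; apply: le_trans (PA x z _); last first.
  by move=> i; apply: le_trans (kz i) _; rewrite ler_nat.
rewrite ler_wpM2r ?normc_ge0// /growth ler_pM ?expR_ge0 ?powR_ge0//.
  by rewrite ler_expR ler_wpM2r// ler_nat.
by apply: ler_powR; rewrite ?lerDl ?sqr_ge0// ler_pM2r// ler_nat.
Qed.

Lemma entire_linz v : entire (linz v).
Proof.
move=> z; apply: (@differentiableM C 'rV[C]_n (fun=> (0 +i* (2 * pi)) : C)
  (fun z => \sum_i (v 0 i)%:C * z 0 i)); first exact: differentiable_cst.
rewrite (_ : (fun z => _) = \sum_i (fun z : 'rV[C]_n => (v 0 i)%:C * z 0 i)); last first.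
  by apply/funext => y; rewrite fct_sumE.
apply: (@differentiable_sum C 'rV[C]_n C^o n (fun i (z : 'rV[C]_n) => (v 0 i)%:C * z 0 i : C^o)).
move=> i; apply: (@differentiableM C 'rV[C]_n (fun=> (v 0 i)%:C) (fun z => z 0 i)).
  exact: differentiable_cst.
exact: differentiable_coord.
Qed.

Lemma regular_mulz v Phi : regular Phi -> regular (mulz v Phi).
Proof.
move=> [cP eP]; split=> [z|x].
  by apply: ccontinuousM; [exact: ccontinuous_cst|exact: cP].
move=> z; apply: (@differentiableM C 'rV[C]_n (linz v) (Phi x)).
  exact: entire_linz.
exact: eP.
Qed.

Definition shiftz (j : 'I_n) (eta : R) Phi : R -> 'rV[C]_n -> C :=
  fun x z => Phi x (z + (0 +i* eta) *: delta_mx 0 j).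

Lemma regular_shiftz j eta Phi : regular Phi -> regular (shiftz j eta Phi).
Proof.
move=> [cP eP]; split=> [z|x z]; first exact: cP.
apply: (@differentiable_comp C _ _ C^o (fun z => z + (0 +i* eta) *: delta_mx 0 j) (Phi x)).
  apply: differentiableD; last exact: differentiable_cst.
  exact: ex_diff.
exact: eP.
Qed.

Lemma shiftz0 j Phi : shiftz j 0 Phi = Phi.
Proof. by apply/funext => x; apply/funext => z; rewrite /shiftz scale0r addr0. Qed.

Lemma admissible_shiftz k Phi A j eta : (2 <= k)%N -> (2 * n <= k)%N ->
  regular Phi -> decays k Phi A -> `|eta| <= k%:R ->
  admissible (shiftz j eta Phi) A.
Proof.
move=> k2 kn rP PA ek; have [cP eP] := regular_shiftz j eta rP; split=> // x xi.
apply: le_trans (decays_le x k2 kn PA _) _.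
  move=> i; rewrite !mxE; case: (i == j) => /=.
    by rewrite !(mul0r, mul1r, mulr0, mulr1, add0r, subr0, addr0).
  by rewrite !(mul0r, mul1r, mulr0, mulr1, add0r, subr0, addr0) normr0.
rewrite le_eqVlt; apply/orP; left; apply/eqP; congr (_ * (_ * _)).
apply: eq_bigr => i _; rewrite !mxE; congr weight1; case: (i == j) => /=;
by rewrite !(mul0r, mul1r, mulr0, mulr1, add0r, subr0, addr0).
Qed.

Lemma admissible_decays k Phi A : (2 <= k)%N -> (2 * n <= k)%N ->
  regular Phi -> decays k Phi A -> admissible Phi A.
Proof.
move=> k2 kn [cP eP] PA; split=> // x xi.
apply: le_trans (decays_le x k2 kn PA _) _.
  by move=> i; rewrite !mxE /= normr0.
rewrite le_eqVlt; apply/orP; left; apply/eqP; congr (_ * (_ * _)).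
by apply: eq_bigr => i _; rewrite !mxE.
Qed.

Lemma weight_le_coord m (T : m.-tuple mR) i : weight T <= weight1 (tnth T i).
Proof.
rewrite /weight (bigD1 i)//= ler_piMr ?(ltW (weight1_gt0 _))//.
apply: prodr_ile1 => k _; rewrite weight1_le1 andbT.
exact/ltW/weight1_gt0.
Qed.

Section shift.
Variables (g : 'rV[R]_1 -> C) (u t : 'rV[R]_n) (Phi : R -> 'rV[C]_n -> C).
Variables (k : nat) (A B eta : R) (j : 'I_n).
Hypotheses (k2 : (2 <= k)%N) (kn : (2 * n <= k)%N).
Hypotheses (rP : regular Phi) (PA : decays k Phi A) (gB : bounded_window g B).
Hypothesis ek : `|eta| <= k%:R.

Let slice (T : n.+1.-tuple mR) (w : C) : C :=
  Phi (tnth T ord0) ((\row_i if i == j then 0 else (tnth T (lift ord0 i))%:C)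
    + w *: delta_mx 0 j)
  * cexpi (2 * pi * t 0 j) w
  * (g (const_mx (dotr u t - tnth T ord0))
     * expi (2 * pi * \sum_(i | i != j) tnth T (lift ord0 i) * t 0 i)).

Let sliceE T s tau : slice T (s +i* tau) =
  (expR (- (2 * pi * t 0 j * tau)))%:C *
  total_integrand g u (shiftz j tau Phi) t (upd T (lift ord0 j) s).
Proof.
rewrite /slice /total_integrand /DSadj_integrand /shiftz /cexpi /=.
rewrite tnth_upd /=.
set z1 := _ + _; set z2 := (X in Phi _ X * _ * expi _).
have -> : z1 = z2.
  apply/rowP => i; rewrite !mxE tnth_mktuple tnth_upd (inj_eq lift_inj).
  case: (i == j) => /=; last by rewrite !mulr0 !addr0.
  by rewrite !mulr1 add0r; congr Complex; rewrite /= ?addr0 ?add0r.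
have -> : dotr (\row_j0 tnth (tuple_tl (upd T (lift ord0 j) s)) j0) t =
    t 0 j * s + \sum_(i | i != j) tnth T (lift ord0 i) * t 0 i.
  rewrite /dotr (bigD1 j)//= !mxE tnth_mktuple tnth_upd eqxx mulrC; congr (_ + _).
  by apply: eq_bigr => i ij; rewrite !mxE tnth_mktuple tnth_upd (inj_eq lift_inj) (negbTE ij).
rewrite [2 * pi * (_ + _)]mulrDr expiD [2 * pi * (t 0 j * s)]mulrA; ring.
Qed.

Let slice_cdiff T w : cdiff (slice T) w.
Proof.
apply: cdiffM; last exact: cdiff_cst.
apply: cdiffM; last exact: cdiff_cexpi.
by apply: cdiff_entire_slice; exact: rP.2.
Qed.

Let adm tau : `|tau| <= `|eta| -> admissible (shiftz j tau Phi) A.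
Proof. by move=> te; exact: (admissible_shiftz j k2 kn rP PA (le_trans te ek)). Qed.

Let slice_le T s tau : `|tau| <= `|eta| ->
  normc (slice T (s +i* tau)) <= (expR (2 * pi * `|t 0 j| * `|eta|) * (A * B)) * weight1 s.
Proof.
move=> te; rewrite sliceE normcM normc_real ger0_norm ?expR_ge0// -[leRHS]mulrA.
have [_ bnd] := ctame_total_integrand u t (adm te) gB.
have := bnd (upd T (lift ord0 j) s) => bT.
have AB : 0 <= A * B.
  by rewrite -(pmulr_lge0 _ (weight_gt0 (upd T (lift ord0 j) s))) (le_trans _ bT)// normc_ge0.
apply: ler_pM; rewrite ?expR_ge0 ?normc_ge0//.
  rewrite ler_expR -mulrN -!mulrA ler_wpM2l// ler_wpM2l ?pi_ge0//.
  by rewrite (le_trans (ler_norm _))// normrM normrN ler_wpM2l.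
apply: le_trans bT _; rewrite ler_wpM2l//.
by apply: le_trans (weight_le_coord _ (lift ord0 j)) _; rewrite tnth_upd eqxx.
Qed.

(** For fixed x and fixed other coordinates, the integrand as a function of
    xi_j extends to an entire function [slice T], dominated by 1/(1+s^2) on the
    strip; its integrals over the lines of height 0 and eta agree, and
    [Rintegral_slice0] carries this over to the full integral. *)
Lemma DSadj_shift : DSadj g u Phi t =
  (expR (- (2 * pi * t 0 j * eta)))%:C * DSadj g u (shiftz j eta Phi) t.
Proof.
have a0 : admissible Phi A by exact: admissible_decays PA.
have ae : admissible (shiftz j eta Phi) A by exact: adm.
set c := (expR _)%:C.
rewrite (DSadjE _ a0 gB) (DSadjE _ ae gB).
have t0 := ctame_total_integrand u t a0 gB.
have te := ctame_total_integrand u t ae gB.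
have tz : ctame (fun _ : n.+1.-tuple mR => 0 : C) 0.
  by split; [split; exact: measurable_cst|move=> T; rewrite normc0 mul0r].
have tce := ctame_lin c te tz.
rewrite -[RHS]addr0 -[X in _ = _ + X](_ : cintegral (lebesgue_tuple R n.+1) (fun _ : n.+1.-tuple mR => 0 : C) = 0); last first.
  by rewrite /cintegral /= !Rintegral_cst// !mul0r.
rewrite -(cintegral_lin c te tz) /cintegral.
have E T s : c * total_integrand g u (shiftz j eta Phi) t (upd T (lift ord0 j) s) + 0 =
    slice T (s +i* eta) by rewrite addr0 sliceE.
have E0 T s : total_integrand g u Phi t (upd T (lift ord0 j) s) = slice T (s +i* 0).
  by rewrite sliceE shiftz0 mulr0 oppr0 expR0 mul1r.
have mupd T : measurable_fun setT (fun s : mR => upd T (lift ord0 j) s).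
  apply/measurable_fun_tnthP => i.
  rewrite (_ : _ \o _ = fun s => if i == lift ord0 j then s else tnth T i); last first.
    by apply/funext => s; rewrite /= tnth_upd.
  by case: (i == _); [exact: measurable_id|exact: measurable_cst].
have reduce (f : C -> R) : (forall z : C, `|f z| <= normc z) ->
    tame (fun T => f (total_integrand g u Phi t T)) ->
    tame (fun T => f (c * total_integrand g u (shiftz j eta Phi) t T + 0)) ->
    (forall T, Rintegral leb setT (fun s => f (slice T (s +i* 0))) =
               Rintegral leb setT (fun s => f (slice T (s +i* eta)))) ->
  Rintegral (lebesgue_tuple R n.+1) setT (fun T => f (total_integrand g u Phi t T)) =
  Rintegral (lebesgue_tuple R n.+1) setT
    (fun T => f (c * total_integrand g u (shiftz j eta Phi) t T + 0)).
  move=> fn fT0 fTe fE; apply/eqP; rewrite -subr_eq0 -RintegralB//; last 2 first.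
  - exact: tame_integrable fT0.
  - exact: tame_integrable fTe.
  apply/eqP; apply: (Rintegral_slice0 (j := lift ord0 j) (tameB fT0 fTe)) => T /=.
  rewrite RintegralB//.
  - under eq_Rintegral do rewrite E0.
    under [X in _ - X]eq_Rintegral do rewrite E.
    by rewrite fE subrr.
  - apply: (integrable_dominated (integrable_weight1 R)).
      exact: (measurableT_comp fT0.1 (mupd T)).
    move=> s /=; rewrite E0; apply: le_trans (fn _) (slice_le _ _ _).
    by rewrite normr0.
  - apply: (integrable_dominated (integrable_weight1 R)).
      exact: (measurableT_comp fTe.1 (mupd T)).
    by move=> s /=; rewrite E; exact: le_trans (fn _) (slice_le _ _ _).
congr Complex; apply: reduce.
- exact: normr_Re_le.
- exact: ctame_Re t0.
- exact: ctame_Re tce.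
- move=> T; apply: (strip_shift_Re (slice_cdiff T)) => s tau; exact: slice_le.
- exact: normr_Im_le.
- exact: ctame_Im t0.
- exact: ctame_Im tce.
- move=> T; apply: (strip_shift_Im (slice_cdiff T)) => s tau; exact: slice_le.
Qed.

End shift.

End decay.

(** * Exponential decay and first derivatives of the transform *)

Section derivatives.
Variable R : realType.
Local Notation C := R[i].
Local Notation RC := (Rcomplex R).

Lemma is_derive_quadratic (V W : normedModType R) (f : V -> W) (t v : V) (l : W) (K : R) :
  (forall h : R, `|f (t + h *: v) - f t - h *: l| <= K * h ^+ 2) -> is_derive t v f l.
Proof.
move=> fK.
suff lim : h^-1 *: ((f \o shift t) (h *: v) - f t) @[h --> 0^'] --> l.
  by apply: DeriveDef; [exact: cvgP lim|exact: cvg_lim lim].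
apply/cvgrPdist_le => e e0.
have K0 : 0 < `|K| + 1 by rewrite ltr_wpDl.
exists (e / (`|K| + 1)); first by rewrite /= divr_gt0.
move=> h /=; rewrite sub0r normrN ltr_pdivlMr// => hK h0.
have -> : l - h^-1 *: (f (h *: v + t) - f t) =
    - (h^-1 *: (f (t + h *: v) - f t - h *: l)).
  by rewrite [h *: v + t]addrC [in RHS]scalerBr scalerA mulVf// scale1r opprB.
rewrite normrN normrZ (le_trans (ler_wpM2l _ (fK h)))//.
rewrite normfV mulrC -mulrA -[h ^+ 2]real_normK ?num_real// expr2 -mulrA divff ?normr_eq0//.
rewrite mulr1 (le_trans _ (ltW hK))// mulrC ler_wpM2l//.
by rewrite (le_trans (ler_norm _))// lerDl.
Qed.

Definition cderive (h : R) (f : R -> C) (f' : C) :=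
  is_derive h 1 (fun y => complex.Re (f y)) (complex.Re f') /\
  is_derive h 1 (fun y => complex.Im (f y)) (complex.Im f').

Lemma cderive_cst h c : cderive h (fun=> c) 0.
Proof. by split; apply: is_derive_cst. Qed.

Lemma cderiveM h (f g : R -> C) f' g' : cderive h f f' -> cderive h g g' ->
  cderive h (fun y => f y * g y) (f' * g h + f h * g').
Proof.
move=> [fr fi] [gr gi]; split.
  rewrite (_ : (fun y => _) = (fun y => complex.Re (f y)) * (fun y => complex.Re (g y))
    - (fun y => complex.Im (f y)) * (fun y => complex.Im (g y))); last first.
    by apply/funext => y; rewrite !fctE; case: (f y) (g y) => ? ? [].
  apply: is_derive_eq; rewrite /GRing.scale /=.
  by case: (f h) (g h) f' g' {fr fi gr gi} => ? ? [? ?] [? ?] [? ?] /=; ring.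
rewrite (_ : (fun y => _) = (fun y => complex.Re (f y)) * (fun y => complex.Im (g y))
  + (fun y => complex.Im (f y)) * (fun y => complex.Re (g y))); last first.
  by apply/funext => y; rewrite !fctE; case: (f y) (g y) => ? ? [].
apply: is_derive_eq; rewrite /GRing.scale /=.
by case: (f h) (g h) f' g' {fr fi gr gi} => ? ? [? ?] [? ?] [? ?] /=; ring.
Qed.

Lemma cderiveD h (f g : R -> C) f' g' : cderive h f f' -> cderive h g g' ->
  cderive h (fun y => f y + g y) (f' + g').
Proof.
move=> [fr fi] [gr gi]; split.
  rewrite (_ : (fun y => _) = (fun y => complex.Re (f y)) + (fun y => complex.Re (g y))); last first.
    by apply/funext => y; rewrite !fctE; case: (f y) (g y) => ? ? [].
  by apply: is_derive_eq; case: f' g' {fr fi gr gi} => ? ? [].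
rewrite (_ : (fun y => _) = (fun y => complex.Im (f y)) + (fun y => complex.Im (g y))); last first.
  by apply/funext => y; rewrite !fctE; case: (f y) (g y) => ? ? [].
by apply: is_derive_eq; case: f' g' {fr fi gr gi} => ? ? [].
Qed.

Lemma cderive_affine h (f : R -> C) f' a b : cderive (a + h * b) f f' ->
  cderive h (fun y => f (a + y * b)) (b%:C * f').
Proof.
have aff : is_derive h 1 (fun y => a + y * b) b.
  apply: (is_derive_quadratic (K := 0)) => k; rewrite mul0r normr_le0.
  by apply/eqP; rewrite /GRing.scale /=; ring.
move=> [fr fi]; split.
  have := @is_derive1_comp R (fun y => complex.Re (f y)) (fun y => a + y * b) h _ _ fr aff.
  rewrite (_ : complex.Re (b%:C * f') = complex.Re f' * b)//.
  by case: f' {fr fi} => ? ? /=; ring.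
have := @is_derive1_comp R (fun y => complex.Im (f y)) (fun y => a + y * b) h _ _ fi aff.
rewrite (_ : complex.Im (b%:C * f') = complex.Im f' * b)//.
by case: f' {fr fi} => ? ? /=; ring.
Qed.

Lemma cderive_expi (x : R) : cderive x (@expi R) ((0 +i* 1) * expi x).
Proof.
split=> /=.
  by rewrite mul0r mul1r sub0r; exact: is_derive_cos.
by rewrite mul0r mul1r add0r; exact: is_derive_sin.
Qed.

Lemma ctaylor2_le (f f1 f2 : R -> C) (h M : R) :
  (forall x, cderive x f (f1 x)) -> (forall x, cderive x f1 (f2 x)) ->
  (forall x, normc (f2 x) <= M) ->
  normc (f h - f 0 - h%:C * f1 0) <= 2 * M * h ^+ 2.
Proof.
move=> ff1 f12 f2M; apply: le_trans (normc_le_ReIm _) _.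
rewrite -mulrA mulr_natl mulr2n; apply: lerD.
  have := @taylor2_le R (fun x => complex.Re (f x)) (fun x => complex.Re (f1 x))
    (fun x => complex.Re (f2 x)) h M (fun x => (ff1 x).1) (fun x => (f12 x).1)
    (fun x _ => le_trans (normr_Re_le _) (f2M x)).
  apply: le_trans; rewrite le_eqVlt; apply/orP; left; apply/eqP; congr `|_|.
  by case: (f h) (f 0) (f1 0) => ? ? [? ?] [? ?] /=; ring.
have := @taylor2_le R (fun x => complex.Im (f x)) (fun x => complex.Im (f1 x))
  (fun x => complex.Im (f2 x)) h M (fun x => (ff1 x).2) (fun x => (f12 x).2)
  (fun x _ => le_trans (normr_Im_le _) (f2M x)).
apply: le_trans; rewrite le_eqVlt; apply/orP; left; apply/eqP; congr `|_|.
by case: (f h) (f 0) (f1 0) => ? ? [? ?] [? ?] /=; ring.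
Qed.

Lemma cincrement_le (f f1 : R -> C) (h M : R) : (forall x, cderive x f (f1 x)) ->
  (forall x, normc (f1 x) <= M) -> normc (f h - f 0) <= 2 * M * `|h|.
Proof.
move=> ff1 f1M; apply: le_trans (normc_le_ReIm _) _.
rewrite -mulrA mulr_natl mulr2n; apply: lerD.
  have := @increment0_le R (fun x => complex.Re (f x)) (fun x => complex.Re (f1 x)) h M
    (fun x => (ff1 x).1) (fun x _ => le_trans (normr_Re_le _) (f1M x)).
  by case: (f h) (f 0) => ? ? [? ?].
have := @increment0_le R (fun x => complex.Im (f x)) (fun x => complex.Im (f1 x)) h M
  (fun x => (ff1 x).2) (fun x _ => le_trans (normr_Im_le _) (f1M x)).
by case: (f h) (f 0) => ? ? [? ?].
Qed.

Lemma cderive_quadratic (f : R -> C) (x : R) (l : C) (K : R) :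
  (forall h : R, normc (f (x + h) - f x - h%:C * l) <= K * h ^+ 2) -> cderive x f l.
Proof.
move=> fK; split; apply: (is_derive_quadratic (K := K)) => h;
rewrite [h *: 1]mulr1; apply: le_trans (fK h).
  apply: le_trans (normr_Re_le _); rewrite le_eqVlt; apply/orP; left; apply/eqP; congr `|_|.
  by case: (f _) (f x) l {fK} => ? ? [? ?] [? ?]; rewrite /GRing.scale /=; ring.
apply: le_trans (normr_Im_le _); rewrite le_eqVlt; apply/orP; left; apply/eqP; congr `|_|.
by case: (f _) (f x) l {fK} => ? ? [? ?] [? ?]; rewrite /GRing.scale /=; ring.
Qed.

Lemma RC_scaleE (r : R) (x : RC) : r *: x = (r%:C * x : C).
Proof. by case: x => x1 x2; rewrite /GRing.mul/= !mul0r subr0 addr0. Qed.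

End derivatives.

Section decay_and_derivatives.
Context {R : realType} {n : nat}.
Local Notation C := R[i].
Local Notation RC := (Rcomplex R).
Local Notation mR := (measurableTypeR R).
Local Notation leb := (@lebesgue_measure R).
Local Notation W := (@total_weight R n.+1).
Implicit Types (Phi : R -> 'rV[C]_n -> C) (g : 'rV[R]_1 -> C) (u t v : 'rV[R]_n).

Lemma total_weight_ge0 m : 0 <= @total_weight R m.
Proof. by apply: Rintegral_ge0 => T _; exact/ltW/weight_gt0. Qed.

Lemma enorm_le_coord t : (1 <= n)%N -> exists j, enorm t <= n%:R * `|t 0 j|.
Proof.
case: n t => // m t _.
have [j _ jmax] := @arg_maxP _ R _ ord0 xpredT (fun i => `|t 0 i|) isT.
exists j; rewrite -[leRHS]ger0_norm ?mulr_ge0// -sqrtr_sqr ler_sqrt ?sqr_ge0//.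
apply: (@le_trans _ _ (\sum_(i < m.+1) `|t 0 j| ^+ 2)).
  apply: ler_sum => i _; rewrite -[leLHS]real_normK ?num_real// lerXn2r ?nnegrE//.
  exact: jmax.
rewrite sumr_const card_ord -[_ ^+ 2 *+ _]mulr_natl exprMn ler_wpM2r ?sqr_ge0//.
by rewrite -natrX ler_nat expnS leq_pmulr// expn1.
Qed.

(** Of the factor exp(- 2 pi eta t_j) won by the contour shift, exp(- n k |t_j|)
    already compensates exp(k|t|), as |t| <= n |t_j| for the largest t_j. *)
Lemma DSadj_decay g u Phi t (k k0 : nat) A B : (1 <= n)%N ->
  (2 <= k0)%N -> (2 * n <= k0)%N -> (n * k <= k0)%N ->
  regular Phi -> decays k0 Phi A -> bounded_window g B ->
  expR (k%:R * enorm t) * normc (DSadj g u Phi t) <= 2 * (A * B) * W.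
Proof.
move=> n1 k2 kn kk rP PA gB; have [j tj] := enorm_le_coord t n1.
pose eta : R := if 0 <= t 0 j then (n * k)%:R else - (n * k)%:R.
have etaE : t 0 j * eta = (n * k)%:R * `|t 0 j|.
  rewrite /eta; case: ifPn => [t0|]; first by rewrite ger0_norm// mulrC.
  by rewrite -ltNge => t0; rewrite ltr0_norm// mulrN mulrC mulrN.
have ek : `|eta| <= k0%:R.
  by rewrite /eta; case: ifP => _; rewrite ?normrN normr_nat ler_nat.
rewrite (DSadj_shift u t j k2 kn rP PA gB ek) normcM normc_real.
rewrite ger0_norm ?expR_ge0// [leLHS]mulrA -expRD -[leRHS]mul1r.
apply: ler_pM; rewrite ?expR_ge0 ?normc_ge0//; last first.
  by apply: normc_DSadj_le => //; exact: (admissible_shiftz j k2 kn rP PA ek).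
rewrite -[X in _ <= X]expR0 ler_expR subr_le0 -mulrA etaE.
apply: (@le_trans _ _ ((n * k)%:R * `|t 0 j|)).
  by rewrite natrM [n%:R * k%:R]mulrC -mulrA ler_wpM2l.
rewrite ler_peMl ?mulr_ge0//.
by have := @pi_ge2 R; lra.
Qed.

Definition window_derivative g g' :=
  forall y : R, cderive y (fun y => g (const_mx y)) (g' (const_mx y)).

Definition total_derivative g g' u v Phi t (T : n.+1.-tuple mR) : C :=
  (dotr u v)%:C * total_integrand g' u Phi t T + total_integrand g u (mulz v Phi) t T.

Lemma dotrDZ u t (h : R) v : dotr u (t + h *: v) = dotr u t + h * dotr u v.
Proof.
rewrite /dotr mulr_sumr -big_split; apply: eq_bigr => i _ /=.
by rewrite !mxE; ring.
Qed.

Lemma cderive_total_integrand g g' u v Phi t T (h : R) : window_derivative g g' ->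
  cderive h (fun h => total_integrand g u Phi (t + h *: v) T)
    (total_derivative g g' u v Phi (t + h *: v) T).
Proof.
move=> gg'; set x := tnth T ord0; set xi : 'rV[R]_n := \row_j tnth (tuple_tl T) j.
set z : 'rV[C]_n := \row_j (tnth (tuple_tl T) j)%:C.
pose G (h : R) := g (const_mx ((dotr u t - x) + h * dotr u v)).
pose E (h : R) := expi (2 * pi * dotr xi t + h * (2 * pi * dotr xi v)).
have totE g1 Psi (k : R) : total_integrand g1 u Psi (t + k *: v) T =
    Psi x z * g1 (const_mx ((dotr u t - x) + k * dotr u v)) * E k.
  rewrite /total_integrand /DSadj_integrand !dotrDZ -/x -/xi -/z /E.
  by congr (_ * g1 (const_mx _) * expi _); ring.
rewrite (_ : (fun h => _) = fun h => Phi x z * G h * E h); last first.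
  by apply/funext => k; rewrite totE.
have lz : linz v z = (0 +i* 1) * (2 * pi * dotr xi v)%:C.
  rewrite /linz (_ : \sum_i (v 0 i)%:C * z 0 i = (dotr xi v)%:C); last first.
    rewrite /dotr rmorph_sum; apply: eq_bigr => i _.
    by rewrite rmorphM /= !mxE mulrC.
  by rewrite [(_ * _)%:C]rmorphM /= mulrA; congr (_ * _); congr Complex; rewrite /=; ring.
have := cderiveM (cderiveM (cderive_cst h (Phi x z))
  (cderive_affine (gg' (dotr u t - x + h * dotr u v))))
  (cderive_affine (cderive_expi (2 * pi * dotr xi t + h * (2 * pi * dotr xi v)))).
rewrite -/(G h) -/(E h) /total_derivative !totE /mulz lz -/(G h).
set d1 := (X in cderive _ _ X); set d2 := (X in _ -> cderive _ _ X).
by have -> : d1 = d2 by rewrite /d1 /d2 /E; ring.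
Qed.

Section increment.
Variables (g g1 g2 : 'rV[R]_1 -> C) (u v : 'rV[R]_n) (Phi : R -> 'rV[C]_n -> C).
Variables (A0 A1 A2 B : R).
Hypothesis P0 : admissible Phi A0.
Hypothesis P1 : admissible (mulz v Phi) A1.
Hypothesis P2 : admissible (mulz v (mulz v Phi)) A2.
Hypothesis gB : bounded_window g B.
Hypothesis g1B : bounded_window g1 B.
Hypothesis g2B : bounded_window g2 B.
Hypothesis gg1 : window_derivative g g1.
Hypothesis gg2 : window_derivative g1 g2.

(** The second derivative of the integrand in the direction v is a combination
    of total integrands for Phi, 2 pi i <v, z> Phi and (2 pi i <v, z>)^2 Phi,
    dominated uniformly in t.  So the pointwise Taylor estimate can be
    integrated, with a constant that is uniform in t as well. *)
Lemma DSadj_increment : exists K : R, forall t (h : R),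
  normc (DSadj g u Phi (t + h *: v) - DSadj g u Phi t
    - h%:C * ((dotr u v)%:C * DSadj g1 u Phi t + DSadj g u (mulz v Phi) t)) <= K * h ^+ 2.
Proof.
set a := (dotr u v)%:C.
pose A' := normc a * (A0 * B) + A1 * B.
pose M := normc a * A' + (normc a * (A1 * B) + A2 * B).
exists (2 * (2 * M) * W) => t h.
have c0 s := ctame_total_integrand u s P0 gB.
have c1 s := ctame_total_integrand u s P0 g1B.
have c2 s := ctame_total_integrand u s P0 g2B.
have d0 s := ctame_total_integrand u s P1 gB.
have d1 s := ctame_total_integrand u s P1 g1B.
have e0 s := ctame_total_integrand u s P2 gB.
have td s : ctame (total_derivative g g1 u v Phi s) A' := ctame_lin a (c1 s) (d0 s).
have td1 s : ctame (total_derivative g1 g2 u v Phi s) A' := ctame_lin a (c2 s) (d1 s).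
have td2 s : ctame (total_derivative g g1 u v (mulz v Phi) s) (normc a * (A1 * B) + A2 * B)
  := ctame_lin a (d1 s) (e0 s).
have t1 := ctame_lin (- h%:C) (td t) (c0 (t + h *: v)).
have t2 := ctame_lin (-1) (c0 t) t1.
rewrite (DSadjE _ P0 gB) (DSadjE _ P0 gB) (DSadjE _ P0 g1B) (DSadjE _ P1 gB).
have ET : cintegral (lebesgue_tuple R n.+1) (total_derivative g g1 u v Phi t) = _ :=
  cintegral_lin a (c1 t) (d0 t).
rewrite -ET.
set I0 := cintegral _ _; set I1 := cintegral _ _; set I2 := cintegral _ _.
have -> : I0 - I1 - h%:C * I2 = -1 * I1 + (- h%:C * I2 + I0) by ring.
rewrite -(cintegral_lin (- h%:C) (td t) (c0 (t + h *: v))) -(cintegral_lin (-1) (c0 t) t1).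
rewrite [leRHS](_ : _ = 2 * (2 * M * h ^+ 2) * W); last by ring.
apply: normc_cintegral; split; first exact: t2.1.
move=> T.
have := @ctaylor2_le R (fun h => total_integrand g u Phi (t + h *: v) T)
  (fun h => total_derivative g g1 u v Phi (t + h *: v) T)
  (fun h => a * total_derivative g1 g2 u v Phi (t + h *: v) T +
            total_derivative g g1 u v (mulz v Phi) (t + h *: v) T) h (M * weight T).
rewrite scale0r addr0.
set D1 := (X in _ -> _ -> _ -> normc X <= _); set D2 := (X in _ -> normc X <= _).
have -> : D2 = D1 by rewrite /D1 /D2; ring.
move=> H; rewrite [leRHS](_ : _ = 2 * (M * weight T) * h ^+ 2); last by ring.
apply: H.
- by move=> x; exact: cderive_total_integrand.
- move=> x; apply: cderiveD.
    have := cderiveM (cderive_cst x a) (cderive_total_integrand u v Phi t T x gg2).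
    by rewrite mul0r add0r.
  exact: cderive_total_integrand.
- move=> x; rewrite mulrDl (le_trans (normcD_le _ _))//; apply: lerD.
    by rewrite normcM -mulrA ler_wpM2l ?normc_ge0// (td1 _).2.
  exact: (td2 _).2.
Qed.

Lemma DSadj_is_derive t : is_derive t v (DSadj g u Phi : 'rV[R]_n -> RC)
  ((dotr u v)%:C * DSadj g1 u Phi t + DSadj g u (mulz v Phi) t : C).
Proof.
have [K DK] := DSadj_increment; apply: (is_derive_quadratic (K := K)) => h.
by rewrite RC_scaleE; exact: DK.
Qed.

(** The mean value inequality along the segment from t to t + v; the constant
    is small with v, which will give continuity of the transform. *)
Lemma DSadj_lipschitz t : normc (DSadj g u Phi (t + v) - DSadj g u Phi t) <=
  2 * (`|dotr u v| * (2 * (A0 * B) * W) + 2 * (A1 * B) * W).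
Proof.
have [K DK] := DSadj_increment.
pose f (h : R) := DSadj g u Phi (t + h *: v).
pose f1 h := (dotr u v)%:C * DSadj g1 u Phi (t + h *: v) + DSadj g u (mulz v Phi) (t + h *: v).
have fE x h : normc (f (x + h) - f x - h%:C * f1 x) <= K * h ^+ 2.
  rewrite /f /f1 (_ : t + (x + h) *: v = t + x *: v + h *: v); first exact: DK.
  by rewrite scalerDl addrA.
have := @cincrement_le R f f1 1 (`|dotr u v| * (2 * (A0 * B) * W) + 2 * (A1 * B) * W) _ _.
rewrite /f scale1r scale0r addr0 normr1 mulr1; apply.
- by move=> x; apply: (cderive_quadratic (K := K)) => h; exact: fE.
- move=> x; rewrite (le_trans (normcD_le _ _))//; apply: lerD.
    by rewrite normcM normc_real ler_wpM2l//; exact: normc_DSadj_le.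
  exact: normc_DSadj_le.
Qed.

End increment.

End decay_and_derivatives.

(** * Iterated derivatives of the transform *)

Lemma continuous_RC_near (R : realType) (X : topologicalType) (f : X -> R[i]) :
  (forall x (e : R), 0 < e -> \forall y \near x, normc (f x - f y) <= e) ->
  continuous (f : X -> Rcomplex R).
Proof. by move=> cf x; apply/cvgrPdist_le => e e0; exact: cf. Qed.

Section iterated_derivatives.
Context {R : realType} {n : nat}.
Local Notation C := R[i].
Local Notation RC := (Rcomplex R).
Local Notation W := (@total_weight R n.+1).
Implicit Types (Phi : R -> 'rV[C]_n -> C) (g : 'rV[R]_1 -> C) (u t v : 'rV[R]_n).

(** Estimates of all orders are required so that the class is stable under
    multiplication by linear forms, which weakens each of them. *)
Definition symbol Phi := regular Phi /\ forall k, exists A, decays k Phi A.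

Definition window_bound (m : nat) g (B : R) :=
  forall i y, (i <= m)%N -> normc (pds (nseq i ord0) g y) <= B.

Definition window g := Cinfty g /\ forall m, exists B, window_bound m g B.

Lemma symbol_mulz v Phi : symbol Phi -> symbol (mulz v Phi).
Proof.
move=> [rP dP]; split; first exact: regular_mulz.
by move=> k; have [A PA] := dP k.+1; exists (mulz_bound v * A); exact: decays_mulz.
Qed.

Lemma symbol_admissible Phi : symbol Phi -> exists A, admissible Phi A.
Proof.
move=> [rP dP]; have [A PA] := dP (2 + 2 * n)%N; exists A.
by apply: (admissible_decays _ _ rP PA); [exact: leq_addr|exact: leq_addl].
Qed.

Lemma pds_nseq_pd m g : pds (nseq m ord0) (pd ord0 g) = pds (nseq m.+1 ord0) g.
Proof.
have -> : nseq m.+1 (ord0 : 'I_1) = nseq m ord0 ++ [:: ord0] by elim: m => //= m <-.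
by rewrite /pds foldr_cat.
Qed.

Lemma window_pd g : window g -> window (pd ord0 g).
Proof.
move=> [sg bg]; split=> [s|m].
  have -> : pds s (pd ord0 g) = pds (s ++ [:: ord0]) g by rewrite /pds foldr_cat.
  exact: sg.
have [B gB] := bg m.+1; exists B => i y im.
by rewrite pds_nseq_pd; exact: gB.
Qed.

Lemma window_bound_pd m g B : window_bound m.+1 g B -> window_bound m (pd ord0 g) B.
Proof. by move=> gB i y im; rewrite pds_nseq_pd; exact: gB. Qed.

Lemma window_bounded m g B : window g -> window_bound m g B -> bounded_window g B.
Proof.
move=> [sg _] gB; split; first exact: continuous_RC (sg [::]).1.
by move=> y; exact: (gB 0%N).
Qed.

Lemma window_derivative_pd g : Cinfty g -> window_derivative g (pd ord0 g).
Proof.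
move=> sg y; have dg := (sg [::]).2 ord0 (const_mx y : 'rV[R]_1).
have lim := dg : cvg _.
have {}lim : (h^-1 *: ((g : 'rV[R]_1 -> RC) (h *: delta_mx 0 ord0 + const_mx y) - g (const_mx y)))
   @[h --> 0^'] --> (pd ord0 g (const_mx y) : RC) := lim.
have mxE' (h : R) : h *: delta_mx 0 ord0 + const_mx y = const_mx (h + y) :> 'rV[R]_1.
  by apply/rowP => i; rewrite !mxE (ord1 i) eqxx mulr1.
have part (p : C -> R) : (forall a b, p (a - b) = p a - p b) ->
    (forall (r : R) a, p (r%:C * a) = r * p a) -> (forall a, `|p a| <= normc a) ->
    is_derive y 1 (fun y => p (g (const_mx y))) (p (pd ord0 g (const_mx y))).
  move=> pB pZ pn.
  suff limp : h^-1 *: (((fun y => p (g (const_mx y))) \o shift y) (h *: 1) - p (g (const_mx y)))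
      @[h --> 0^'] --> p (pd ord0 g (const_mx y)).
    by apply: DeriveDef; [exact: cvgP limp|exact: cvg_lim limp].
  apply/cvgrPdist_le => e e0; move/cvgrPdist_le: lim => /(_ e e0).
  apply: filterS => h; apply: le_trans => /=.
  have E : h^-1 *: (p (g (const_mx (h + y))) - p (g (const_mx y))) =
      p ((h^-1)%:C * (g (const_mx (h + y)) - g (const_mx y))) by rewrite pZ pB.
  by rewrite mxE' [h *: 1]mulr1 E -pB RC_scaleE; exact: pn.
split; apply: part.
- by move=> [? ?] [? ?].
- by move=> r [? ?] /=; ring.
- exact: normr_Re_le.
- by move=> [? ?] [? ?].
- by move=> r [? ?] /=; ring.
- exact: normr_Im_le.
Qed.

Section derivative_of_symbol.
Variables (g : 'rV[R]_1 -> C) (u : 'rV[R]_n) (Phi : R -> 'rV[C]_n -> C).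
Hypotheses (wg : window g) (sP : symbol Phi).

Let bounds v : exists A0 A1 A2 B,
  [/\ admissible Phi A0, admissible (mulz v Phi) A1,
    admissible (mulz v (mulz v Phi)) A2, bounded_window g B &
    bounded_window (pd ord0 g) B /\ bounded_window (pd ord0 (pd ord0 g)) B].
Proof.
have [A0 P0] := symbol_admissible sP.
have [A1 P1] := symbol_admissible (symbol_mulz v sP).
have [A2 P2] := symbol_admissible (symbol_mulz v (symbol_mulz v sP)).
have [B gB] := wg.2 2%N; exists A0, A1, A2, B; split => //.
  exact: window_bounded gB.
split; first exact: window_bounded (window_pd wg) (window_bound_pd gB).
exact: window_bounded (window_pd (window_pd wg)) (window_bound_pd (window_bound_pd gB)).
Qed.

Lemma symbol_is_derive v t : is_derive t v (DSadj g u Phi : 'rV[R]_n -> RC)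
  ((dotr u v)%:C * DSadj (pd ord0 g) u Phi t + DSadj g u (mulz v Phi) t : C).
Proof.
have [A0 [A1 [A2 [B [P0 P1 P2 gB [g1B g2B]]]]]] := bounds v.
apply: (DSadj_is_derive u P0 P1 P2 gB g1B g2B).
  exact: window_derivative_pd wg.1.
exact: window_derivative_pd (window_pd wg).1.
Qed.

Lemma symbol_continuous : continuous (DSadj g u Phi : 'rV[R]_n -> RC).
Proof.
have [rP dP] := sP; have [A PA] := dP (2 + 2 * n).+2.
have [B gB] := wg.2 2%N; have g0 := window_bounded wg gB.
have g1 := window_bounded (window_pd wg) (window_bound_pd gB).
have g2 := window_bounded (window_pd (window_pd wg)) (window_bound_pd (window_bound_pd gB)).
have k2 : (2 <= 2 + 2 * n)%N by exact: leq_addr.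
have kn : (2 * n <= 2 + 2 * n)%N by exact: leq_addl.
have PA1 := decays_leq (leqnSn _) PA.
have P0 := admissible_decays k2 kn rP (decays_leq (leqnSn _) PA1).
have P1 v := admissible_decays k2 kn (regular_mulz v rP) (decays_mulz v PA1).
have P2 v := admissible_decays k2 kn (regular_mulz v (regular_mulz v rP))
  (decays_mulz v (decays_mulz v PA)).
have d1 := window_derivative_pd wg.1; have d2 := window_derivative_pd (window_pd wg).1.
pose X := 2 * (A * B) * W.
have X0 : 0 <= X by apply: le_trans (normc_DSadj_le u P0 g0 0); exact: normc_ge0.
pose K := 2 * ((\sum_i `|u 0 i|) * X + 2 * pi * n%:R * X).
have U0 : 0 <= \sum_i `|u 0 i| by exact: sumr_ge0.
have K0 : 0 <= K.
  rewrite /K; apply: mulr_ge0 => //; apply: addr_ge0; apply: mulr_ge0 => //.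
  by rewrite !mulr_ge0 ?pi_ge0.
have lip t v (d : R) : 0 <= d -> (forall i, `|v 0 i| <= d) ->
    normc (DSadj g u Phi (t + v) - DSadj g u Phi t) <= d * K.
  move=> d0 vd; apply: le_trans (DSadj_lipschitz u P0 (P1 v) (P2 v) g0 g1 g2 d1 d2 t) _.
  rewrite [leRHS](_ : _ = 2 * (d * (\sum_i `|u 0 i|) * X + d * (2 * pi * n%:R) * X));
    last by rewrite /K; ring.
  rewrite ler_wpM2l//; apply: lerD.
    apply: ler_wpM2r => //; rewrite (le_trans (ler_norm_sum _ _ _))// mulr_sumr.
    by apply: ler_sum => i _; rewrite normrM mulrC ler_wpM2r.
  rewrite (_ : 2 * (_ * A * B) * W = mulz_bound v * X); last by rewrite /X; ring.
  rewrite ler_wpM2r// /mulz_bound mulrCA ler_wpM2l ?mulr_ge0 ?pi_ge0//.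
  apply: (@le_trans _ _ (\sum_(i < n) d)); first exact: ler_sum.
  by rewrite sumr_const card_ord -[d *+ n]mulr_natr.
apply: continuous_RC_near => t e e0.
have K1 : 0 < K + 1 by rewrite ltr_wpDl.
apply/nbhs_ballP; exists (e / (K + 1)); first by rewrite /= divr_gt0.
move=> y [_ ty]; have eK : 0 <= e / (K + 1) by rewrite divr_ge0 ?ltW.
rewrite -normcN opprB -{1}(subrKC t y).
apply: le_trans (lip t (y - t) (e / (K + 1)) eK _) _.
  by move=> i; rewrite !mxE distrC; apply: ltW; exact: ty.
by rewrite mulrAC ler_pdivrMr// ler_wpM2l ?(ltW e0)// lerDl.
Qed.

End derivative_of_symbol.

(** Each derivative falls on the window or on the exponential. *)
Fixpoint iterated (s : seq 'I_n) g u Phi : 'rV[R]_n -> C :=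
  if s is i :: s' then
    (u 0 i)%:C *: iterated s' (pd ord0 g) u Phi + iterated s' g u (mulz (delta_mx 0 i) Phi)
  else DSadj g u Phi.

Lemma dotr_delta u i : dotr u (delta_mx 0 i) = u 0 i.
Proof.
rewrite /dotr (bigD1 i)//= mxE !eqxx mulr1 big1 ?addr0// => j ji.
by rewrite mxE (negbTE ji) andbF mulr0.
Qed.

Lemma iterated_cons i s g u Phi t : iterated (i :: s) g u Phi t =
  (u 0 i)%:C * iterated s (pd ord0 g) u Phi t + iterated s g u (mulz (delta_mx 0 i) Phi) t.
Proof. by []. Qed.

(** The recursion of [iterated] applies the letters of the word from the outside
    in, whereas a derivative adds a letter at the front.  The two orders agree
    because multiplications by linear forms commute. *)
Lemma iterated_derive s g u Phi i t : window g -> symbol Phi ->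
  derivable (iterated s g u Phi : 'rV[R]_n -> RC) t (delta_mx 0 i) /\
  'D_(delta_mx 0 i) (iterated s g u Phi : 'rV[R]_n -> RC) t = iterated (i :: s) g u Phi t.
Proof.
elim: s g Phi => [|j s IHs] g Phi wg sP.
  have [d dE] := symbol_is_derive u wg sP (delta_mx 0 i) t; split=> //.
  by rewrite dE dotr_delta.
have [d1 D1] := IHs _ _ (window_pd wg) sP.
have [d2 D2] := IHs _ _ wg (symbol_mulz (delta_mx 0 j) sP).
split; first exact: derivable_lincomb d1 d2.
by rewrite [LHS](derive_lincomb _ d1 d2) D1 D2 !iterated_cons mulzC; ring.
Qed.

Lemma iterated_continuous s g u Phi : window g -> symbol Phi ->
  continuous (iterated s g u Phi : 'rV[R]_n -> RC).
Proof.
elim: s g Phi => [|j s IHs] g Phi wg sP; first exact: symbol_continuous.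
move=> t /=.
have ct := cvg_mulC (a := (u 0 j)%:C) (FF := nbhs_filter t) (IHs _ _ (window_pd wg) sP t).
exact: cvgD ct (IHs _ _ wg (symbol_mulz (delta_mx 0 j) sP) t).
Qed.

Lemma pds_DSadj s g u Phi : window g -> symbol Phi ->
  pds s (DSadj g u Phi) = iterated s g u Phi.
Proof.
move=> wg sP; elim: s => [//|i s IHs]; rewrite [LHS]/= IHs.
by apply/funext => t; have [] := iterated_derive s u i t wg sP.
Qed.

Lemma Cinfty_DSadj g u Phi : window g -> symbol Phi -> Cinfty (DSadj g u Phi).
Proof.
move=> wg sP s; rewrite pds_DSadj//; split; first exact: iterated_continuous.
by move=> i t; have [] := iterated_derive s u i t wg sP.
Qed.

Lemma decays_ge0 k Phi A : decays k Phi A -> 0 <= A.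
Proof.
move=> PA; apply: le_trans (PA 0 0 _); first by rewrite mulr_ge0 ?growth_ge0 ?normc_ge0.
by move=> i; rewrite mxE /= normr0.
Qed.

Lemma window_bound_ge0 m g B : window_bound m g B -> 0 <= B.
Proof. by move=> gB; apply: le_trans (gB 0%N 0 _) => //; exact: normc_ge0. Qed.

(** The constants depend on the length of the word only: each letter uses up one
    unit of decay of the symbol and one derivative of the window.  The sum over
    all i in the new constant majorizes the contribution of any first
    letter. *)
Lemma iterated_le u (k N : nat) : (1 <= n)%N -> exists (K : R) (k0 : nat), 0 <= K /\
  forall s g Phi A B t, (size s <= N)%N -> regular Phi -> decays k0 Phi A ->
    window g -> window_bound N g B ->
  expR (k%:R * enorm t) * normc (iterated s g u Phi t) <= K * A * B.
Proof.
move=> n1; elim: N => [|N [K [k0 [K0 IH]]]].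
  exists (2 * W), (2 + 2 * n + n * k)%N; split.
    by rewrite mulr_ge0// total_weight_ge0.
  move=> [|//] g Phi A B t _ rP PA wg gB /=.
  rewrite (_ : 2 * W * A * B = 2 * (A * B) * W); last by ring.
  apply: DSadj_decay PA (window_bounded wg gB) => //.
  - by rewrite addnAC leq_addl.
  - by rewrite leq_addl.
exists (K + \sum_i (`|u 0 i| * K + K * mulz_bound (delta_mx 0 i))), k0.+1.
have s0 (i : 'I_n) : 0 <= `|u 0 i| * K + K * mulz_bound (delta_mx 0 i).
  by rewrite addr_ge0// mulr_ge0// mulz_bound_ge0.
split; first by rewrite addr_ge0// sumr_ge0.
move=> s g Phi A B t sN rP PA wg gB.
have A0 := decays_ge0 PA; have B0 := window_bound_ge0 gB.
have gB' : window_bound N g B by move=> i y iN; apply: gB; exact: leqW.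
case: s sN => [_|i s]; last rewrite ltnS => sN.
  apply: le_trans (IH [::] g Phi A B t _ rP (decays_leq (leqnSn _) PA) wg gB') _ => //.
  by rewrite -!mulrA ler_wpM2r ?mulr_ge0// lerDl sumr_ge0.
have h1 := IH s _ Phi A B t sN rP (decays_leq (leqnSn _) PA) (window_pd wg) (window_bound_pd gB).
have h2 := IH s g _ _ B t sN (regular_mulz (delta_mx 0 i) rP) (decays_mulz (delta_mx 0 i) PA) wg gB'.
have E0 : 0 <= expR (k%:R * enorm t) by exact: expR_ge0.
rewrite /=.
apply: le_trans (ler_wpM2l E0 (normcD_le _ _)) _; rewrite mulrDr.
rewrite [(_ *: _ : 'rV[R]_n -> C) t]/(_ * _) normcM normc_real.
apply: (@le_trans _ _ ((`|u 0 i| * K + K * mulz_bound (delta_mx 0 i)) * A * B)).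
  rewrite !mulrDl; apply: lerD.
    by rewrite mulrCA -!mulrA ler_wpM2l// mulrA.
  by rewrite -[K * _ * A]mulrA.
rewrite -!mulrA ler_wpM2r ?mulr_ge0// (bigD1 i)//= addrCA lerDl addr_ge0//.
by apply: sumr_ge0.
Qed.

End iterated_derivatives.

(** * The continuous bilinear operator *)

Section assembly.
Context {R : realType} {n : nat}.
Local Notation C := R[i].
Local Notation RC := (Rcomplex R).
Implicit Types (Phi Psi : KU R n) (g : K1 R 1) (u t : 'rV[R]_n) (k m : nat).

Lemma ereal_sup_real (S : set \bar R) (y : R) : S y%:E -> (ereal_sup S < +oo)%E ->
  ereal_sup S = (fine (ereal_sup S))%:E.
Proof.
by move=> /ereal_sup_ubound; case: (ereal_sup S).
Qed.

Lemma smooth_entire_regular (F : R -> 'rV[C]_n -> C) : smooth_entire F -> regular F.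
Proof.
move=> [sF eF]; split=> // z; apply: continuous_RC => x.
have dF : differentiable (fun y => F y z : RC) x.
  by apply/derivable1_diffP; exact: (sF z 0%N x).
by have := differentiable_continuous dF; exact.
Qed.

Lemma rhoKU_decays k (F : R -> 'rV[C]_n -> C) (A : R) :
  (rhoKU (k, 0%N) F <= A%:E)%E -> decays k F A.
Proof.
move=> FA x z kz; rewrite -lee_fin; apply: le_trans FA.
by apply: ereal_sup_ubound; exists x => //; exists z.
Qed.

Definition KUnorm k Phi : R := fine (rhoKU (k, 0%N) Phi).

Lemma KUnormE k Phi : rhoKU (k, 0%N) Phi = (KUnorm k Phi)%:E.
Proof.
have /asboolP[_ finPhi] := KU_valP Phi.
apply: (@ereal_sup_real _ (growth k 0 (0 : 'rV[C]_n) * normc (Phi 0 (0 : 'rV[C]_n)))); last exact: finPhi.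
by exists 0 => //; exists 0 => // i; rewrite mxE /= normr0.
Qed.

Lemma KUnorm_decays k Phi : decays k Phi (KUnorm k Phi).
Proof. by apply: rhoKU_decays; rewrite KUnormE. Qed.

Lemma symbol_KU Phi : symbol Phi.
Proof.
have /asboolP[sPhi _] := KU_valP Phi; split; first exact: smooth_entire_regular.
by move=> k; exists (KUnorm k Phi); exact: KUnorm_decays.
Qed.

Definition K1norm m g : R := fine (rho m g).

Lemma K1normE m g : rho m g = (K1norm m g)%:E.
Proof.
have /asboolP[_ fing] := K1_valP g.
apply: (@ereal_sup_real _ (expR (m%:R * enorm (0 : 'rV[R]_1)) * normc (pdm (fun=> 0%N) g 0)));
  last exact: fing.
by exists 0 => //; exists (fun=> 0%N) => //=; rewrite big1.
Qed.

Lemma K1norm_window_bound m g : window_bound m g (K1norm m g).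
Proof.
move=> i y im; rewrite -lee_fin -K1normE.
apply: (@le_trans _ _ (expR (m%:R * enorm y) * normc (pdm (fun=> i) g y))%:E); last first.
  apply: ereal_sup_ubound; exists y => //; exists (fun=> i) => //=.
  by rewrite big_ord1.
rewrite lee_fin /pdm enum_ordSl (size0nil (size_enum_ord 0)) /= cats0.
rewrite ler_peMl ?normc_ge0// -expR0 ler_expR mulr_ge0//.
exact: sqrtr_ge0.
Qed.

Lemma window_K1 g : window g.
Proof.
have /asboolP[sg _] := K1_valP g; split=> // m.
by exists (K1norm m g); exact: K1norm_window_bound.
Qed.

Lemma size_multi_index (alpha : 'I_n -> nat) :
  size (flatten [seq nseq (alpha i) i | i <- enum 'I_n]) = (\sum_i alpha i)%N.
Proof.
rewrite size_flatten /shape -map_comp sumnE big_map big_enum /=.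
by apply: eq_bigr => i _; rewrite size_nseq.
Qed.

(** Each [pdm alpha] is the derivative along a word of length at most k, to
    which [iterated_le] applies. *)
Lemma rho_DSadj_le k u : (1 <= n)%N -> exists (K : R) (k0 : nat), 0 <= K /\
  forall Phi g, (rho k (DSadj g u Phi) <= (K * KUnorm k0 Phi * K1norm k g)%:E)%E.
Proof.
move=> n1; have [K [k0 [K0 h]]] := iterated_le u k k n1.
exists K, k0; split=> // Phi g; apply: ge_ereal_sup => _ [t _ [alpha ak <-]].
rewrite lee_fin /pdm pds_DSadj; [|exact: window_K1|exact: symbol_KU].
apply: h.
- by rewrite size_multi_index.
- exact: (symbol_KU Phi).1.
- exact: KUnorm_decays.
- exact: window_K1.
- exact: K1norm_window_bound.
Qed.

Section operator.
Variables (u : 'rV[R]_n) (n_ge1 : (1 <= n)%N).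

Lemma DSadj_K1 Phi g : DSadj g u Phi \in K1_pred.
Proof.
apply/asboolP; split; first exact: Cinfty_DSadj (window_K1 g) (symbol_KU Phi).
by move=> k; have [K [k0 [_ h]]] := rho_DSadj_le k u n_ge1; rewrite (le_lt_trans (h _ _))// ltry.
Qed.

Definition DSadj_op Phi g : K1 R n := MkK1 (DSadj_K1 Phi g).

Let adm Phi : exists A, admissible Phi A.
Proof. exact: symbol_admissible (symbol_KU Phi). Qed.
Let bdd g : exists B, bounded_window g B.
Proof. by exists (K1norm 0 g); exact: window_bounded (window_K1 g) (@K1norm_window_bound 0 g). Qed.

Lemma DSadj_lin (a : C) (F G H : R -> 'rV[C]_n -> C) (f g h : 'rV[R]_1 -> C) A B A' B' A'' B'' t :
  admissible F A -> bounded_window f B -> admissible G A' -> bounded_window g B' ->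
  admissible H A'' -> bounded_window h B'' ->
  (forall x z y, H x z * h y = a * (F x z * f y) + G x z * g y) ->
  DSadj h u H t = a * DSadj f u F t + DSadj g u G t.
Proof.
move=> FA fB GA gB HA hB E; rewrite (DSadjE _ FA fB) (DSadjE _ GA gB) (DSadjE _ HA hB).
rewrite -(cintegral_lin a (ctame_total_integrand u t FA fB) (ctame_total_integrand u t GA gB)).
congr (cintegral _ _); apply/funext => T.
by rewrite /total_integrand /DSadj_integrand E; ring.
Qed.

Lemma DSadj_op_bilinear : bilinear_for
  (GRing.Scale.Law.clone _ _ ( *:%R : C -> K1 R n -> K1 R n) _)
  (GRing.Scale.Law.clone _ _ ( *:%R : C -> K1 R n -> K1 R n) _) DSadj_op.
Proof.
split=> [g a Phi Psi|Phi a f g]; apply/val_inj/funext => t /=.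
  have [A PA] := adm Phi; have [A' PA'] := adm Psi; have [A'' PA''] := adm (a *: Phi + Psi).
  have [B gB] := bdd g.
  apply: (DSadj_lin t PA gB PA' gB PA'' gB) => x z y.
  by rewrite [KU_val _ x z](_ : _ = a * Phi x z + Psi x z)//; ring.
have [A PA] := adm Phi; have [B fB] := bdd f; have [B' gB] := bdd g.
have [B'' hB] := bdd (a *: f + g).
apply: (DSadj_lin t PA fB PA gB PA hB) => x z y.
by rewrite [K1_val _ y](_ : _ = a * f y + g y)//; ring.
Qed.

HB.instance Definition _ := bilinear_isBilinear.Build C (KU R n) (K1 R 1) (K1 R n)
  _ _ DSadj_op DSadj_op_bilinear.

Lemma rho_K1D k (f g : K1 R n) : (rho k ((f + g)%R : K1 R n) <= rho k f + rho k g)%E.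
Proof.
have /asboolP[cf _] := K1_valP f; have /asboolP[cg _] := K1_valP g.
exact: (rhoD k cf cg).
Qed.

(** With a and b the norms of Phi0 and g0, differences below d <= 1 change the
    value by at most K (d^2 + d b + a d) <= d K (1 + a + b). *)
Lemma DSadj_op_near k Phi0 (g0 : K1 R 1) (e : R) : 0 < e ->
  \forall p \near (Phi0, g0), (rho k ((DSadj_op p.1 p.2 - DSadj_op Phi0 g0)%R : K1 R n) < e%:E)%E.
Proof.
move=> e0; have [K [k0 [K0 le]]] := rho_DSadj_le k u n_ge1.
pose a := `|KUnorm k0 Phi0|; pose b := `|K1norm k g0|.
pose D := K * (1 + a + b) + 1.
have a0 : 0 <= a by exact: normr_ge0.
have b0 : 0 <= b by exact: normr_ge0.
have D0 : 0 < D by rewrite ltr_wpDl// mulr_ge0// !addr_ge0.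
pose d := Num.min 1 (e / D).
have d0 : 0 < d by rewrite lt_min ltr01 divr_gt0.
exists ([set Phi | (rhoKU (k0, 0%N) ((Phi - Phi0)%R : KU R n) < d%:E)%E],
        [set g | (rho k ((g - g0)%R : K1 R 1) < d%:E)%E]).
  split.
    by exists ([:: (k0, 0%N)], d) => // Phi; apply; rewrite inE.
  by exists ([:: k], d) => // g; apply; rewrite inE.
move=> [Phi g] [dPhi dg].
rewrite [(Phi, g).1]/= [(Phi, g).2]/=.
have {}dPhi : (rhoKU (k0, 0%N) ((Phi - Phi0)%R : KU R n) < d%:E)%E := dPhi.
have {}dg : (rho k ((g - g0)%R : K1 R 1) < d%:E)%E := dg.
have -> : (DSadj_op Phi g - DSadj_op Phi0 g0 : K1 R n) =
    DSadj_op (Phi - Phi0) (g - g0) + (DSadj_op (Phi - Phi0) g0 + DSadj_op Phi0 (g - g0)).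
  rewrite !linearBl [_ + DSadj_op Phi0 (g - g0)]addrC addrA subrK.
  by rewrite linearBr addrA subrK.
apply: le_lt_trans (rho_K1D _ _ _) _.
apply: (@le_lt_trans _ _ (K * d * d + (K * d * b + K * a * d))%:E); last first.
  rewrite lte_fin.
  have d1 : d <= 1 by rewrite ge_min lexx.
  have dD : d * D <= e by rewrite -ler_pdivlMr// ge_min lexx orbT.
  have : K * d * d <= K * d by rewrite ler_piMr// mulr_ge0// ltW.
  move: dD; rewrite /D; lra.
have nPhi : 0 <= KUnorm k0 (Phi - Phi0) by exact: decays_ge0 (KUnorm_decays _).
have ng : 0 <= K1norm k (g - g0) by exact: window_bound_ge0 (@K1norm_window_bound _ _).
have nPhid : KUnorm k0 (Phi - Phi0) <= d by rewrite -lee_fin -KUnormE ltW.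
have ngd : K1norm k (g - g0) <= d by rewrite -lee_fin -K1normE ltW.
rewrite EFinD; apply: leeD.
  apply: le_trans (le _ _) _; rewrite lee_fin ler_pM// ?mulr_ge0//.
  by rewrite ler_wpM2l.
apply: le_trans (rho_K1D _ _ _) _; rewrite EFinD; apply: leeD.
  apply: le_trans (le _ _) _; rewrite lee_fin.
  apply: (@le_trans _ _ (K * KUnorm k0 (Phi - Phi0) * b)).
    by rewrite ler_wpM2l ?mulr_ge0// ler_norm.
  by rewrite ler_wpM2r// ler_wpM2l.
apply: le_trans (le _ _) _; rewrite lee_fin.
apply: (@le_trans _ _ (K * a * K1norm k (g - g0))).
  by rewrite ler_wpM2r// ler_wpM2l// ler_norm.
by rewrite ler_wpM2l// mulr_ge0.
Qed.

Lemma DSadj_op_continuous : continuous (fun p : KU R n * K1 R 1 => DSadj_op p.1 p.2).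
Proof.
move=> [Phi0 g0] U [[s e] /= e0 sU].
suff : \forall p \near (Phi0, g0), forall k, k \in s ->
    (rho k ((DSadj_op p.1 p.2 - DSadj_op Phi0 g0)%R : K1 R n) < e%:E)%E.
  by apply: filterS => p ps; apply: sU => k ks; exact: ps.
elim: s {sU} => [|k s IHs]; first by apply: filterE => p j; rewrite in_nil.
move: (DSadj_op_near k Phi0 g0 e0) IHs; apply: filterS2 => p pk ps j.
by rewrite inE => /orP[/eqP ->|/ps].
Qed.

End operator.

End assembly.

Theorem theorem3p2 (R : realType) (n : nat) (n_ge1 : (1 <= n)%N)
    (u : 'rV[R]_n) (u_sphere : enorm u = 1) :
  (forall (Phi : KU R n) (g : K1 R 1) (t : 'rV[R]_n),
      DSadj_integrable g u Phi t) /\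
  exists DS : {bilinear KU R n -> K1 R 1 -> K1 R n},
    (forall (Phi : KU R n) (g : K1 R 1) (t : 'rV[R]_n),
        DS Phi g t = DSadj g u Phi t) /\
    continuous (fun p : KU R n * K1 R 1 => DS p.1 p.2).
Proof.
split=> [Phi g t|].
  have [A PA] := symbol_admissible (symbol_KU Phi).
  have gB := window_bounded (window_K1 g) (@K1norm_window_bound R 0 g).
  exact: DSadj_integrable_admissible PA gB t.
exists (DSadj_op u n_ge1); split=> //.
exact: DSadj_op_continuous.
Qed.
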